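(* Let $f:[0,1]\to[0,1]$ be a continuous, increasing bijection with the following property (P): for every $a\in(0,1)$ and $i,j\in\mathbb{N}_0$, the rational function $r_{i,j}(z,a,f)$ has exact type $(i,j)$, and furthermore $\frac{r_{i,j}(z,a,f)-f(z)}{f(z)}$ equioscillates exactly $i+j+2$ times on $[f^{-1}(a),1]$, achieves its maximum at $z=f^{-1}(a)$, and achieves an extremum at $z=1$. Let $\alpha\in(0,1)$ and $m,\ell\in\mathbb{N}_0$, and define functions $f_k(z)$ and numbers $\alpha_k$ recursively by $$f_{k+1}(z)=f_k(z)\,\hat r_{m,\ell}\left(f^{-1}\left(\frac{f(z)}{f_k(z)}\right),\alpha_k,f\right),\quad f_0(z)=1,$$ $$\alpha_{k+1}=\frac{\alpha_k}{\hat r_{m,\ell}(f^{-1}(\alpha_k),\alpha_k,f)},\quad \alpha_0=\alpha.$$ Let $\widetilde f_k(z)=\frac{2\alpha_k}{1+\alpha_k}f_k(z)$ and $\varepsilon_k=\max_{z\in[f^{-1}(\alpha),1]}\left|\frac{\widetilde f_k(z)-f(z)}{f(z)}\right|$. Then: (1) For every $k\ge 0$, $\alpha_k=\frac{1-\varepsilon_k}{1+\varepsilon_k}$ and $\varepsilon_{k+1}=E_{m,\ell}(f,[f^{-1}(\alpha_k),1])$. (2) For every $k\ge 0$, the relative error $\frac{\widetilde f_k(z)-f(z)}{f(z)}$ equioscillates $(m+\ell+1)^k+1$ times on $[f^{-1}(\alpha),1]$, and it achieves its extrema at the endpoints. (3) If $f\in C^{m+\ell+1}([\alpha,1])$, $f^{-1}$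 is Lipschitz on $[\alpha,1]$, and $(m,\ell)\neq(0,0)$, then $\varepsilon_k\to 0$ monotonically with order of convergence $m+\ell+1$ as $k\to\infty$.
   Context: $\mathcal{R}_{m,\ell}$ is the set of rational functions of type $(m,\ell)$, i.e. ratios of (real) polynomials of degree $\le m$ to polynomials of degree $\le\ell$. A function $g/h\in\mathcal{R}_{m,\ell}$ has exact type $(m',\ell')$ if, after canceling common factors, $g$ and $h$ have degree exactly $m'$ and $\ell'$. For a continuous increasing bijection $f:[0,1]\to[0,1]$ and $\alpha\in(0,1)$, $r_{m,\ell}(\cdot,\alpha,f)$ denotes the (unique) best approximant $$r_{m,\ell}(\cdot,\alpha,f)=\operatorname{arg\,min}_{r\in\mathcal{R}_{m,\ell}}\max_{z\in[f^{-1}(\alpha),1]}\left|\frac{r(z)-f(z)}{f(z)}\right|,$$ and $\hat r_{m,\ell}(\cdot,\alpha,f)$ is the unique scalar multiple of $r_{m,\ell}(\cdot,\alpha,f)$ satisfying $\min_{z\in[f^{-1}(\alpha),1]}\frac{\hat r_{m,\ell}(z,\alpha,f)-f(z)}{f(z)}=0$. $E_{m,\ell}(f,S)=\min_{r\in\mathcal{R}_{m,\ell}}\max_{z\in S}\left|\frac{r(z)-f(z)}{f(z)}\right|$. A continuous function $g$ equioscillates $N$ times on $[a,b]$ if there are points $a\le z_0<z_1<\dots<z_{N-1}\le b$ and $\sigma\in\{-1,1\}$ with $g(z_j)=\sigma(-1)^j\max_{z\in[a,b]}|g(z)|$ for $j=0,\dots,N-1$; it equioscillates exactly $N$ times if $N$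 is the largest such number. For an equioscillating function, ''achieving an extremum at a point'' means that $|g|$ equals $\max_{[a,b]}|g|$ at that point. The functions $f_k$ are considered for $z\in[f^{-1}(\alpha),1]$. Convergence $\varepsilon_k\to0$ with order $q$ means $\varepsilon_k\to 0$ and $\varepsilon_{k+1}=O(\varepsilon_k^{q})$ as $k\to\infty$. *)

(* Defs.v *)
From mathcomp Require Import all_boot all_order all_algebra.
From mathcomp Require Import all_classical all_reals all_analysis.
Set Implicit Arguments.
Unset Strict Implicit.
Unset Printing Implicit Defensive.
Import Order.TTheory GRing.Theory Num.Theory.
Import numFieldNormedType.Exports.
Local Open Scope classical_set_scope.
Local Open Scope ring_scope.

(** Rational functions, seen as functions on the line.  Asking the fraction to
    be reduced loses nothing and makes removable singularities harmless: with
    [x / 0 = 0], an unreduced fraction would take a wrong value there.  A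
    reduced fraction is unbounded near each of its real poles. *)
Definition ratfun (R : realType) (m l : nat) : set (R -> R) :=
  [set r | exists g h : {poly R},
    [/\ (size g <= m.+1)%N, (size h <= l.+1)%N, h != 0, coprimep g h
      & r = (fun z => g.[z] / h.[z])] ].

Definition has_exact_type (R : realType) (m l : nat) (r : R -> R) : Prop :=
  exists g h : {poly R},
    [/\ size g = m.+1, size h = l.+1, coprimep g h
      & r = (fun z => g.[z] / h.[z])].

Definition relerr (R : realType) (f r : R -> R) : R -> R :=
  fun z => (r z - f z) / f z.

(** Supremum norm on [S], equal to [+oo] when [g] is unbounded on [S] (this
    excludes rational functions with a pole in [S] from minimization); it is the
    maximum of [|g|] when [g] is continuous and [S] is compact. *)
Definition maxnorm (R : realType) (S : set R) (g : R -> R) : \bar R :=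
  ereal_sup [set (`|g z|)%:E | z in S].

(** The minimum is attained, e.g. for the functions satisfying [propertyP]
    below, where [rbest] attains it. *)
Definition Emin (R : realType) (m l : nat) (f : R -> R) (S : set R) : \bar R :=
  ereal_inf [set maxnorm S (relerr f r) | r in @ratfun R m l].

(** Inverse on [[0,1]] of a bijection of [[0,1]]. *)
Definition inv01 (R : realType) (f : R -> R) : R -> R := 'pinv_(fun=> 0) `[0, 1]%classic f.

Definition approx_itv (R : realType) (f : R -> R) (a : R) : set R :=
  `[inv01 f a, 1]%classic.

Definition is_best_approx (R : realType) (m l : nat) (a : R) (f r : R -> R) : Prop :=
  ratfun m l r /\
  forall s, ratfun m l s ->
    (maxnorm (approx_itv f a) (relerr f r) <= maxnorm (approx_itv f a) (relerr f s))%E.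

(** The best approximant exists and is unique, so that the choice made by [xget]
    is immaterial; the default value [0] has no exact type. *)
Definition rbest (R : realType) (m l : nat) (a : R) (f : R -> R) : R -> R :=
  xget (fun=> 0) [set r | is_best_approx m l a f r].

(** The scalar multiple of the best approximant whose relative error has
    minimum [0]. *)
Definition rhat (R : realType) (m l : nat) (a : R) (f : R -> R) : R -> R :=
  xget (fun=> 0) [set s |
    [/\ exists c : R, s = (fun z => c * rbest m l a f z),
        exists2 z, approx_itv f a z & relerr f s z = 0
      & forall z, approx_itv f a z -> 0 <= relerr f s z] ].

Definition equioscillates (R : realType) (N : nat) (a b : R) (g : R -> R) : Prop :=
  {within `[a, b], continuous g} /\
  exists (z : nat -> R) (sigma : R),
    [/\ sigma = 1 \/ sigma = -1,
        forall j, (j < N)%N -> a <= z j <= b,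
        forall j, (j.+1 < N)%N -> z j < z j.+1
      & forall j, (j < N)%N ->
          (g (z j))%:E = ((sigma * (-1) ^+ j)%:E * maxnorm `[a, b] g)%E].

Definition equioscillates_exactly (R : realType) (N : nat) (a b : R) (g : R -> R) :
    Prop :=
  equioscillates N a b g /\
  forall N', equioscillates N' a b g -> (N' <= N)%N.

Definition extremum_at (R : realType) (a b : R) (g : R -> R) (x : R) : Prop :=
  (`|g x|)%:E = maxnorm `[a, b] g.

Definition incr_bij01 (R : realType) (f : R -> R) : Prop :=
  [/\ {within `[0, 1], continuous f},
      {in `[0, 1] &, {homo f : x y / x < y}}
    & set_bij `[0, 1] `[0, 1] f].

Definition propertyP (R : realType) (f : R -> R) : Prop :=
  forall (a : R) (i j : nat), 0 < a < 1 ->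
    let r := rbest i j a f in
    [/\ has_exact_type i j r,
        equioscillates_exactly (i + j + 2) (inv01 f a) 1 (relerr f r),
        forall z, approx_itv f a z -> relerr f r z <= relerr f r (inv01 f a)
      & extremum_at (inv01 f a) 1 (relerr f r) 1].

Fixpoint alpha_iter (R : realType) (f : R -> R) (m l : nat) (alpha : R) (k : nat) : R :=
  if k is k'.+1 then
    let ak := alpha_iter f m l alpha k' in ak / rhat m l ak f (inv01 f ak)
  else alpha.

Fixpoint f_iter (R : realType) (f : R -> R) (m l : nat) (alpha : R) (k : nat) : R -> R :=
  if k is k'.+1 then
    let fk := f_iter f m l alpha k' in
    fun z => fk z * rhat m l (alpha_iter f m l alpha k') f (inv01 f (f z / fk z))
  else fun=> 1.

Definition ft_iter (R : realType) (f : R -> R) (m l : nat) (alpha : R) (k : nat) :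
    R -> R :=
  let ak := alpha_iter f m l alpha k in
  fun z => 2 * ak / (1 + ak) * f_iter f m l alpha k z.

Definition eps_iter (R : realType) (f : R -> R) (m l : nat) (alpha : R) (k : nat) : R :=
  fine (maxnorm (approx_itv f alpha) (relerr f (ft_iter f m l alpha k))).

(** [C^n] on a subset of the line without isolated points: derivatives are
    limits of difference quotients within [A], hence one-sided at the endpoints
    of an interval, and values outside [A] do not matter. *)
Fixpoint class_C (R : realType) (n : nat) (A : set R) (F : R -> R) : Prop :=
  if n is n'.+1 then
    exists F' : R -> R,
      (forall x, A x ->
         (fun y => (F y - F x) / (y - x)) @ within A x^' --> F' x) /\
      class_C n' A F'
  else {within A, continuous F}.

(* Main.v *)
Require Import Defs.
From mathcomp Require Import all_boot all_order all_algebra.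
From mathcomp Require Import all_classical all_reals all_analysis.
From mathcomp Require Import zify ring lra.
Import Order.TTheory GRing.Theory Num.Theory.
Import numFieldNormedType.Exports.
Local Open Scope classical_set_scope.
Local Open Scope ring_scope.

(** Let [e] be the relative error of the best approximant of type [(m, l)] on
    [[f^-1 a, 1]], and [E] its maximum.  Then [rhat = r / (1 - E)], and the
    quotients [u_k = f / f_k] satisfy [u_(k+1) = phi (u_k)], where
    [phi y = y / rhat (f^-1 y) = (1 - E) / (1 + e (f^-1 y))] for [a = alpha_k].
    By property (P), [phi] takes alternately its minimum [alpha_(k+1)] and its
    maximum [1] at [m + l + 2] points, from [alpha_k] to [1].  By the intermediate
    value theorem alternations multiply under composition ([zigzag_refine]), so
    [u_k] takes alternately the values [alpha_k] and [1] at [(m + l + 1)^k + 1]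
    points.  The relative error of [ft_k] is [2 alpha_k / (1 + alpha_k) / u_k - 1],
    which gives the first two claims, with [eps_k = (1 - alpha_k) / (1 + alpha_k)]
    and [eps_(k+1) = E].

    Comparison with a constant shows that [eps_k] decreases.  It tends to [0]
    since a slowly increasing function of type [(1, 0)] or [(0, 1)] beats the
    constants by a fixed factor as long as [alpha_k] stays away from [1]
    ([level_map_growth]).

    For the order of convergence it remains to see that the best error on
    [[x, 1]] is [O((1 - x)^(m+l+1))].  This holds if [f] has an [(m, l)] Pade
    approximant at [1] whose denominator does not vanish there, which may fail
    for a general [f]; property (P) excludes it ([no_pade_defect]).  Suppose that
    it fails.  Then ([pade_or_defect]) there is a reduced fraction [G / H] for
    which [F = H f - G] vanishes at [1] to an exact order [n] with
    [deg G + deg H + 2 <= n <= m + l].  Let [g / h], with [h > 0], be the best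
    approximant on a small interval [[x, 1]] of a type [(i, j)] with
    [i = n - deg H - 1].  The function [H (h f - g) = h F + W] alternates at
    [i + j + 2] points, starting with a negative sign, and [W = h G - g H] is a
    polynomial of degree less than [n].  By Rolle's theorem [W] is small, so that
    [(g, h)] is close to a multiple [(q G, q H)] with [deg q <= j - deg H].
    - For [j = deg H], [q] is a positive constant, and the sign of the derivative
      of order [n] of [h F], which is that of the same derivative of [F] at [1],
      is [(-1)^(n+1)] ([defect_sign0]).
    - For [j = deg H + 1], the derivative of order [n] of [h F] changes sign,
      which forces [q] to be close to a multiple of [z - 1]; positivity of [h]
      makes this multiple positive, and the derivative of order [n + 1] of [h F]
      shows that the same sign is [(-1)^n] ([defect_sign1]).
    These two conclusions contradict each other.  The extrema of the errors have
    the same sign at the left endpoint for all types, and this is what makes the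
    argument work. *)

Set Implicit Arguments.
Unset Strict Implicit.
Unset Printing Implicit Defensive.

(** * Pade approximants of a polynomial *)

Lemma coef0_dvdX (F : fieldType) (p : {poly F}) : ('X %| p) = (p`_0 == 0).
Proof. by rewrite -['X]subr0 -polyC0 dvdp_XsubCl rootE horner_coef0. Qed.

Lemma dvdXn_coef (F : fieldType) (p : {poly F}) n :
  reflect (forall r, (r < n)%N -> p`_r = 0) ('X^n %| p).
Proof.
apply: (iffP idP) => [/dvdpP[q ->] r rn|p0]; first by rewrite coefMXn rn.
have -> : p = drop_poly n p * 'X^n.
  rewrite -[LHS](poly_take_drop n) (_ : take_poly n p = 0) ?add0r//.
  apply/polyP => i; rewrite coef_take_poly coef0; by case: ifP => // /p0.
exact: dvdp_mulIr.
Qed.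

Lemma rVpoly_sum (F : fieldType) d (v : 'rV[F]_d) :
  rVpoly v = \sum_(a < d) v 0 a *: 'X^a.
Proof.
rewrite -[LHS]coefK (poly_def (size _)).
rewrite (big_ord_widen d (fun a => (rVpoly v)`_a *: 'X^a)) ?size_poly//.
rewrite big_mkcond; apply: eq_bigr => a _; rewrite coef_rVpoly_ord.
by case: ltnP => // /leq_sizeP/(_ _ (leqnn _)); rewrite coef_rVpoly_ord => ->; rewrite scale0r.
Qed.

(** The linearized Pade equations always have a nonzero solution: there are
    [l + 1] unknown coefficients of [h] for the [l] conditions that make the
    coefficients of [h * T] of degrees [m + 1, ..., m + l] vanish. *)
Lemma pade_linear_solution (F : fieldType) (T : {poly F}) m l :
  exists g h : {poly F}, [/\ (size g <= m.+1)%N, (size h <= l.+1)%N, h != 0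
    & forall r, (r <= m + l)%N -> (h * T - g)`_r = 0].
Proof.
pose M := \matrix_(a < l.+1, b < l) ('X^a * T)`_(m.+1 + b).
have /rowV0Pn[v /sub_kermxP vM vn0] : kermx M != 0.
  by rewrite -mxrank_eq0 mxrank_ker -lt0n subn_gt0 ltnS rank_leq_col.
pose h := rVpoly v.
exists (take_poly m.+1 (h * T)), h; split; first exact: size_take_poly.
- exact: size_poly.
- by apply: contra vn0 => /eqP h0; rewrite -(rVpolyK v) -/h h0 linear0.
move=> r rml; rewrite coefB coef_take_poly ltnS; case: leqP => [|mr]; first by rewrite subrr.
rewrite subr0.
have rl : (r - m.+1 < l)%N by lia.
have /rowP/(_ (Ordinal rl)) := vM; rewrite !mxE => vM0; rewrite -[RHS]vM0.
rewrite /h rVpoly_sum mulr_suml coef_sum; apply: eq_bigr => a _.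
by rewrite !mxE /= subnKC// -scalerAl coefZ.
Qed.

(** Either [T] has a genuine [(m, l)] Pade approximant (denominator nonzero at
    [0]), or some reduced fraction [G / H] approximates [T] to an exact order [n]
    which exceeds its number of free parameters, [size G + size H - 1], but is at
    most [m + l]; such a fraction fills a block of size at least two of the Pade
    table. *)
Lemma pade_or_defect (F : fieldType) (T : {poly F}) m l : T`_0 != 0 ->
  (exists g h : {poly F}, [/\ (size g <= m.+1)%N, (size h <= l.+1)%N, h`_0 != 0,
      coprimep g h & forall r, (r <= m + l)%N -> (h * T - g)`_r = 0]) \/
  (exists (G H : {poly F}) n, [/\ coprimep G H, H`_0 != 0, G != 0,
      (size G + size H <= n <= m + l)%N
    & (forall r, (r < n)%N -> (H * T - G)`_r = 0) /\ (H * T - G)`_n != 0]).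
Proof.
move=> T0; have [g [h [sg sh hn0 hTg]]] := pade_linear_solution T m l.
pose D := gcdp g h; have Dn0 : D != 0 by rewrite gcdp_eq0 negb_and hn0 orbT.
have gE : g = g %/ D * D by rewrite divpK// dvdp_gcdl.
have hE : h = h %/ D * D by rewrite divpK// dvdp_gcdr.
set G := g %/ D in gE; set H := h %/ D in hE.
have cGH : coprimep G H by apply: coprimep_div_gcd; rewrite hn0 orbT.
have Hn0 : H != 0 by apply: contraNneq hn0 => H0; rewrite hE H0 mul0r.
have shE : size h = (size H + size D).-1 by rewrite hE size_mul.
have sD0 : (0 < size D)%N by rewrite size_poly_gt0.
have sH0 : (0 < size H)%N by rewrite size_poly_gt0.
pose p := (m + l).+1.
have Xp : 'X^p %| D * (H * T - G).
  by rewrite mulrBr mulrA (mulrC D H) -hE (mulrC D G) -gE; apply/dvdXn_coef.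
(* [d] is the order of vanishing of the gcd at [0]; cancelling it gains [d] orders *)
have [d [D' D'0 DE]] := multiplicity_XsubC D 0.
rewrite polyC0 subr0 in DE; rewrite Dn0 /= in D'0.
have sDd : (d < size D)%N.
  have D'n0 : D' != 0 by apply: contraNneq Dn0 => D'00; rewrite DE D'00 mul0r.
  rewrite DE size_mulXn// -[X in (X < _)%N]addn0 ltn_add2l size_poly_gt0//.
have Xpd : 'X^(p - d) %| H * T - G.
  have : 'X^(p - d) * 'X^d %| (D' * (H * T - G)) * 'X^d.
    rewrite -exprD subnK; last by rewrite /p; lia.
    by rewrite mulrAC -DE.
  rewrite dvdp_mul2r ?expf_neq0 ?polyX_eq0// Gauss_dvdpr// coprimep_expl//.
  by rewrite -['X]subr0 -polyC0 coprimep_sym coprimep_XsubC.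
have HT0 : (H * T)`_0 = G`_0.
  apply/eqP; rewrite -subr_eq0 -coefB; apply/eqP.
  by have /dvdXn_coef -> // := Xpd; rewrite /p; lia.
have H0 : H`_0 != 0.
  apply/eqP => H00; move: cGH; rewrite coprimep_def.
  have : 'X %| gcdp G H.
    by rewrite dvdp_gcd !coef0_dvdX H00 -HT0 coef0M H00 mul0r !eqxx.
  move=> /dvdp_leq; rewrite gcdp_eq0 negb_and Hn0 orbT size_polyX => /(_ isT).
  by case: (size _) => [|[]].
have Gn0 : G != 0.
  apply/eqP => G0; move: HT0; rewrite G0 coef0 coef0M => /eqP.
  by rewrite mulf_eq0 (negbTE H0) (negbTE T0).
have sG0 : (0 < size G)%N by rewrite size_poly_gt0.
have sgE : size g = (size G + size D).-1 by rewrite gE size_mul.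
case: (boolP ('X^p %| H * T - G)) => [/dvdXn_coef HTG|nd].
  left; exists G, H; split => //.
  - move: sg sD0; rewrite sgE; move: (size G) (size D) => a b.
    by clear; lia.
  - move: sh sD0; rewrite shE; move: (size H) (size D) => a b.
    by clear; lia.
right; exists G, H.
have [n np nn0] : exists2 n, (n < p)%N & (H * T - G)`_n != 0.
  apply: contrapT => nx; move/negP: nd; apply; apply/dvdXn_coef => r rp.
  by apply/eqP; apply: contrapT => /negP rn; apply: nx; exists r.
have [n' n'0 n'min] := ex_minnP (ex_intro (fun n => (H * T - G)`_n != 0) n nn0).
exists n'; split => //; last first.
  by split => // r rn; apply/eqP; apply: contraTT rn => /n'min; rewrite -leqNgt.
have n'p : (n' < p)%N by apply: leq_ltn_trans np; apply: n'min.
have : (p - d <= n')%N.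
  rewrite leqNgt; apply: contra n'0 => n'd; apply/eqP.
  by move/dvdXn_coef: Xpd; apply.
rewrite /p in n'p *; move: sg sh sDd n'p; rewrite sgE shE.
move: (size G) (size H) (size D) => a b c; clear; lia.
Qed.

(** * Chains of derivatives and alternation of signs *)

Section DerivChain.
Context {R : realType}.
Implicit Types (a b c s B : R) (n N k r i : nat) (D : nat -> R -> R) (h W T : {poly R}).

(** [D 0, D 1, ..., D n] are continuous on [[a, b]], and each is the derivative
    of the previous one inside the interval.  Working with the whole chain avoids
    iterated derivatives and their one-sided versions at the endpoints. *)
Definition deriv_chain a b n D : Prop :=
  (forall r, (r <= n)%N -> {within `[a, b], continuous (D r)}) /\
  (forall r x, (r < n)%N -> a < x < b -> is_derive x 1 (D r) (D r.+1 x)).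

Lemma deriv_chain_sub a b a' n n' D : a <= a' -> (n' <= n)%N ->
  deriv_chain a b n D -> deriv_chain a' b n' D.
Proof.
move=> aa' nn' [cD dD]; split => [r rn|r x rn /andP[ax xb]].
  apply: continuous_subspaceW (cD r (leq_trans rn nn')) => x /=.
  by rewrite !in_itv /= => /andP[ax ->]; rewrite (le_trans aa' ax).
by apply: dD; [exact: leq_trans nn'|rewrite (le_lt_trans aa' ax)].
Qed.

Lemma deriv_chain_lin a b n D1 D2 c1 c2 :
  deriv_chain a b n D1 -> deriv_chain a b n D2 ->
  deriv_chain a b n (fun r x => c1 * D1 r x + c2 * D2 r x).
Proof.
move=> [cD1 dD1] [cD2 dD2]; split => [r rn|r x rn xab].
  move=> x; apply: cvgD; apply: cvgM; try exact: cvg_cst.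
    exact: cD1.
  exact: cD2.
exact: is_deriveD (is_deriveZ c1 (dD1 r x rn xab)) (is_deriveZ c2 (dD2 r x rn xab)).
Qed.

(** The chain of the constant function [1]; the chain of a polynomial in [x - b]
    is [pmul b W one_chain]. *)
Definition one_chain : nat -> R -> R := fun r _ => (r == 0%N)%:R.

Lemma deriv_chain_one a b n : deriv_chain a b n one_chain.
Proof.
split => [r rn|r x rn xab]; first by move=> x; exact: cvg_cst.
exact: is_derive_cst.
Qed.

(** The chain of [(x - b) * D 0], by Leibniz' rule. *)
Definition mulX b D : nat -> R -> R :=
  fun r x => (x - b) * D r x + r%:R * D r.-1 x.

Lemma deriv_chain_mulX a b n D : deriv_chain a b n D -> deriv_chain a b n (mulX b D).
Proof.
move=> [cD dD]; split => [r rn|r x rn xab].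
  move=> x; apply: cvgD; apply: cvgM; try exact: cvg_cst.
  - apply: cvgB; last exact: cvg_cst.
    by apply: (@continuous_subspaceT _ _ `[a, b] idfun) => y; exact: cvg_id.
  - exact: cD.
  - by apply: cD; exact: leq_trans (leq_pred _) rn.
have dXb : is_derive x 1 (id - cst b : R -> R) (1 - 0).
  by apply: is_deriveB.
have d1 := is_deriveM dXb (dD r x rn xab).
case: r => [|r] in rn d1 *.
  apply: is_derive_eq.
    have d0 := is_deriveZ 0 (dD 0%N x rn xab).
    exact: (is_deriveD d1 d0).
  rewrite /mulX /= /GRing.scale /= subr0; cbn; ring.
have d2 : is_derive x 1 (fun x => r.+1%:R * D r x) (r.+1%:R * D r.+1 x).
  exact: is_deriveZ (dD r x (ltnW rn) xab).
have -> : mulX b D r.+1 = (id - cst b) * D r.+1 + (fun x => r.+1%:R * D r x) by [].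
apply: (is_derive_eq (is_deriveD d1 d2)).
rewrite /mulX /= /GRing.scale /= subr0 -[r.+2]addn1 natrD; cbn; ring.
Qed.

(** The chain of [h.[x - b] * D 0 x]. *)
Definition pmul b h D : nat -> R -> R :=
  fun r x => \sum_(i < size h) h`_i * iter i (mulX b) D r x.

Lemma pmul_widen b h D k r x : (size h <= k)%N ->
  pmul b h D r x = \sum_(i < k) h`_i * iter i (mulX b) D r x.
Proof.
move=> hk; rewrite /pmul (big_ord_widen k (fun i => h`_i * iter i (mulX b) D r x))//.
rewrite big_mkcond; apply: eq_bigr => i _; case: ltnP => // hi.
by rewrite nth_default ?mul0r.
Qed.

Lemma deriv_chain_iter a b n D i :
  deriv_chain a b n D -> deriv_chain a b n (iter i (mulX b) D).
Proof. by move=> cD; elim: i => //= i IH; exact: deriv_chain_mulX. Qed.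

Lemma deriv_chain_pmul a b n D h : deriv_chain a b n D -> deriv_chain a b n (pmul b h D).
Proof.
move=> cD; rewrite /pmul; elim: (size h) => [|k IH].
  under eq_fun do under eq_fun do rewrite big_ord0.
  by split => [r rn x|r x rn xab]; [exact: cvg_cst|exact: is_derive_cst].
under eq_fun do under eq_fun do rewrite big_ord_recr /=.
have := deriv_chain_lin 1 h`_k IH (deriv_chain_iter k cD).
by under eq_fun do under eq_fun do rewrite mul1r.
Qed.

Lemma iter_mulX0 b D i x : iter i (mulX b) D 0 x = (x - b) ^+ i * D 0 x.
Proof.
elim: i => [|i IH]; first by rewrite expr0 mul1r.
by rewrite iterS /mulX mul0r addr0 IH exprS mulrA.
Qed.

Lemma pmul0 b D h x : pmul b h D 0 x = h.[x - b] * D 0 x.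
Proof.
by rewrite horner_coef mulr_suml; apply: eq_bigr => i _; rewrite iter_mulX0 mulrA.
Qed.

(** [T], in the variable [x - b], agrees with the Taylor expansion of [D 0] at [b]
    up to the order [n]. *)
Definition jet b n D T := forall r, (r <= n)%N -> D r b = T`_r * r`!%:R.

Lemma jet_one b n : jet b n one_chain 1.
Proof.
by move=> r _; rewrite /one_chain coef1; case: r => [|r]; rewrite ?mul0r ?mulr1.
Qed.

Lemma jet_mulX b n D T : jet b n D T -> jet b n (mulX b D) ('X * T).
Proof.
move=> jD r rn; rewrite /mulX subrr mul0r add0r coefXM.
case: r rn => [|r] rn /=; first by rewrite !mul0r.
by rewrite jD 1?ltnW// factS natrM; ring.
Qed.

Lemma jet_iter b n D T i : jet b n D T -> jet b n (iter i (mulX b) D) ('X^i * T).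
Proof.
move=> jD; elim: i => [|i IH]; first by rewrite expr0 mul1r.
by rewrite iterS exprS -mulrA; exact: jet_mulX.
Qed.

Lemma jet_pmul b n D T h : jet b n D T -> jet b n (pmul b h D) (h * T).
Proof.
move=> jD r rn; rewrite /pmul -[in RHS](coefK h) poly_def mulr_suml coef_sum mulr_suml.
by apply: eq_bigr => i _; rewrite (jet_iter i jD)// -scalerAl coefZ mulrA.
Qed.

Lemma iter_mulX_one b i r x : (i < r)%N -> iter i (mulX b) one_chain r x = 0.
Proof.
elim: i r => [|i IH] [|r]//= ir.
by rewrite /mulX !IH ?mulr0 ?addr0//; lia.
Qed.

Lemma pmul_one_eq0 b W r x : (size W <= r)%N -> pmul b W one_chain r x = 0.
Proof.
move=> Wr; rewrite /pmul big1// => i _; rewrite iter_mulX_one ?mulr0//.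
exact: leq_trans (ltn_ord i) Wr.
Qed.

Lemma deriv_chain_MVT a b n D r x y : deriv_chain a b n D -> (r < n)%N ->
  a <= x -> x < y -> y <= b ->
  exists2 z, x < z < y & D r y - D r x = D r.+1 z * (y - x).
Proof.
move=> [cD dD] rn ax xy yb.
have [||z] := @MVT R (D r) (D r.+1) x y xy.
- move=> z; rewrite in_itv /= => /andP[xz zy].
  by apply: dD => //; rewrite (le_lt_trans ax xz) (lt_le_trans zy yb).
- apply: continuous_subspaceW (cD r (ltnW rn)) => z /=.
  by rewrite !in_itv /= => /andP[xz zy]; rewrite (le_trans ax xz) (le_trans zy yb).
- by rewrite in_itv /= => zxy E; exists z.
Qed.

(** [u] has alternating signs at [k + 1] increasing points of [[a, b]]; the sign
    at the first one is that of [s]. *)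
Definition alternates a b k s (u : R -> R) := exists y : nat -> R,
  [/\ forall j, (j <= k)%N -> a <= y j <= b,
      forall j, (j < k)%N -> y j < y j.+1
    & forall j, (j <= k)%N -> 0 < s * (-1) ^+ j * u (y j)].

(** Rolle's theorem for strict sign changes. *)
Lemma alternates_deriv a b n D r k s : deriv_chain a b n D -> (r < n)%N ->
  alternates a b k.+1 s (D r) -> alternates a b k (- s) (D r.+1).
Proof.
move=> cD rn [y [yab yinc ys]].
have zP j : exists z, (j < k.+1)%N ->
    y j < z < y j.+1 /\ 0 < - s * (-1) ^+ j * D r.+1 z.
  case: (ltnP j k.+1) => [jk|]; last by exists 0.
  have /andP[ay _] := yab j (ltnW jk); have /andP[_ yb] := yab j.+1 jk.
  have [z zy E] := deriv_chain_MVT cD rn ay (yinc j jk) yb.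
  exists z => _; split => //.
  have y0 : 0 < y j.+1 - y j by rewrite subr_gt0 yinc.
  rewrite -(pmulr_lgt0 _ y0) -[X in 0 < X]mulrA -E.
  have := ys j (ltnW jk); have := ys j.+1 jk; rewrite exprS; move: (D r _) (D r _).
  move=> u v; lra.
have [z {}zP] := choice zP; exists z; split => j jk.
- have [/andP[z1 z2] _] := zP j jk.
  have /andP[ay _] := yab j (leqW jk); have /andP[_ yb] := yab j.+1 jk.
  by rewrite (ltW (le_lt_trans ay z1)) (ltW (lt_le_trans z2 yb)).
- have [/andP[_ z2] _] := zP j (leqW jk); have [/andP[z1 _] _] := zP j.+1 jk.
  exact: lt_trans z2 z1.
- by have [_] := zP j jk.
Qed.

Lemma alternates_iter a b n D r k s : deriv_chain a b n D -> (r <= n)%N ->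
  alternates a b (k + r) s (D 0%N) -> alternates a b k ((-1) ^+ r * s) (D r).
Proof.
move=> cD; elim: r k => [|r IH] k rn; first by rewrite addn0 expr0 mul1r.
rewrite addnS -addSn => /IH -/(_ (ltnW rn)) /(alternates_deriv cD rn).
by rewrite exprS -mulrA mulN1r.
Qed.

(** If the [n]-th derivative vanishes and each lower derivative is at most [B]
    at one point and at least [- B] at another, then all of them are at most
    [n * B] in absolute value: integrate downwards from the order [n]. *)
Lemma deriv_chain_small a b n D B : b - a <= 1 -> deriv_chain a b n D -> 0 <= B ->
  (forall x, a <= x <= b -> D n x = 0) ->
  (forall r, (r < n)%N -> (exists2 x, a <= x <= b & D r x <= B) /\
                          (exists2 x, a <= x <= b & - B <= D r x)) ->
  forall r x, (r <= n)%N -> a <= x <= b -> `|D r x| <= (n - r)%:R * B.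
Proof.
move=> ab cD B0 Dn0 DB r x rn.
have [k] := ubnP (n - r); elim: k => // k IH in r x rn *; rewrite ltnS => nrk xab.
have [E|rn'] := eqVneq r n; first by rewrite E Dn0// normr0 subnn mul0r.
have {rn'} rn' : (r < n)%N by rewrite ltn_neqAle rn' rn.
have step u v : a <= u <= b -> a <= v <= b -> `|D r u - D r v| <= (n - r.+1)%:R * B.
  wlog uv : u v / v < u.
    move=> H uab vab; have [|uv|->] := ltgtP v u; first by move=> ?; exact: H.
      by rewrite distrC; exact: H.
    by rewrite subrr normr0 mulr_ge0.
  move=> /andP[au ub] /andP[av vb].
  have [z /andP[vz zu] ->] := deriv_chain_MVT cD rn' av uv ub.
  rewrite normrM -[leRHS]mulr1; apply: ler_pM => //.
    apply: IH; [exact: rn'|by move: nrk rn'; clear; lia|].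
    by rewrite (ltW (le_lt_trans av vz)) (ltW (lt_le_trans zu ub)).
  by rewrite gtr0_norm ?subr_gt0//; lra.
have [[u uab uB] [v vab vB]] := DB r rn'.
have := step _ _ xab uab; have := step _ _ xab vab.
have -> : (n - r)%:R * B = (n - r.+1)%:R * B + B.
  by rewrite -[X in _ = _ + X]mul1r -mulrDl natr1 subnSK.
by rewrite !ler_norml => /andP[+ _] /andP[_ +]; lra.
Qed.

Lemma within_continuous_bounded a b (u : R -> R) : a <= b ->
  {within `[a, b], continuous u} ->
  exists2 B, 0 <= B & forall x, a <= x <= b -> `|u x| <= B.
Proof.
move=> ab cu; have [c cab uc] := EVT_max ab cu; have [d dab ud] := EVT_min ab cu.
exists (`|u c| + `|u d|) => [|x xab]; first by rewrite addr_ge0.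
have xab' : x \in `[a, b] by rewrite in_itv.
have := uc x xab'; have := ud x xab'.
have := ler_norm (u c); have := lerNnormlW (lexx `|u d|).
have := normr_ge0 (u c); have := normr_ge0 (u d).
by rewrite ler_norml; move: (u x) => ? *; apply/andP; split; lra.
Qed.

(** Taylor estimate for a chain that vanishes to the order [N] at [b]. *)
Lemma deriv_chain_order a b n N D : a <= b -> deriv_chain a b n D -> (N <= n)%N ->
  (forall r, (r < N)%N -> D r b = 0) ->
  exists2 B, 0 <= B & forall r x, (r <= n)%N -> a <= x <= b ->
    `|D r x| <= B * (b - x) ^+ (N - r).
Proof.
move=> ab cD Nn D0.
have [B B0 DB] : exists2 B, 0 <= B & forall r x, (r <= n)%N -> a <= x <= b ->
    `|D r x| <= B.
  elim: n {Nn} cD => [|n IH] cD.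
    have [B B0 HB] := within_continuous_bounded ab (cD.1 0%N (leqnn _)).
    by exists B => // -[|r]// x _; exact: HB.
  have [|B B0 HB] := IH; first exact: deriv_chain_sub (lexx a) _ cD.
  have [C C0 HC] := within_continuous_bounded ab (cD.1 n.+1 (leqnn _)).
  exists (B + C) => [|r x]; first by rewrite addr_ge0.
  rewrite leq_eqVlt => /orP[/eqP->|rn] xab; first by rewrite ler_wpDl// HC.
  by rewrite ler_wpDr// HB.
exists B => // r x rn xab.
have [k] := ubnP (N - r); elim: k => // k IH in r x rn xab *; rewrite ltnS => Nrk.
have [Nr|rN] := leqP N r.
  by rewrite (_ : N - r = 0)%N ?expr0 ?mulr1 ?DB//; apply/eqP; rewrite subn_eq0.
have /andP[ax xb] := xab.
have [->|xnb] := eqVneq x b; first by rewrite D0 ?normr0 ?mulr_ge0 ?exprn_ge0 ?subrr.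
have xb' : x < b by rewrite lt_neqAle xnb.
have [z /andP[xz zb]] := deriv_chain_MVT cD (leq_trans rN Nn) ax xb' (lexx b).
rewrite D0// sub0r => E; rewrite -normrN E normrM.
rewrite -subnSK// exprSr [leRHS]mulrA [`|b - x|]ger0_norm ?subr_ge0//.
apply: ler_wpM2r; first by rewrite subr_ge0.
apply: le_trans (IH r.+1 z (leq_trans rN Nn) _ _) _; first by rewrite (ltW (le_lt_trans ax xz)) ltW.
  by move: Nrk rN; clear; lia.
apply: ler_wpM2l => //; apply: lerXn2r; rewrite ?nnegrE ?subr_ge0 ?(ltW zb)//.
by rewrite lerD2l lerN2 ltW.
Qed.

Lemma mulX_order a b n N D B : b - a <= 1 -> 0 <= B ->
  (forall r x, (r <= n)%N -> a <= x <= b -> `|D r x| <= B * (b - x) ^+ (N - r)) ->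
  forall r x, (r <= n)%N -> a <= x <= b ->
    `|mulX b D r x| <= n.+1%:R * B * (b - x) ^+ (N.+1 - r).
Proof.
move=> ab B0 DB r x rn xab; have /andP[ax xb] := xab.
have bx0 : 0 <= b - x by rewrite subr_ge0.
have bx1 : b - x <= 1 by lra.
apply: le_trans (ler_normD _ _) _; rewrite !normrM distrC (ger0_norm bx0) normr_nat.
have -> : n.+1%:R * B * (b - x) ^+ (N.+1 - r) =
   B * (b - x) ^+ (N.+1 - r) + n%:R * (B * (b - x) ^+ (N.+1 - r)).
  by rewrite -nat1r; ring.
apply: lerD.
  apply: le_trans (ler_wpM2l bx0 (DB r x rn xab)) _.
  rewrite mulrCA -exprS; apply: ler_wpM2l => //.
  by apply: ler_wiXn2l => //; lia.
case: r rn => [|r] rn; first by rewrite mul0r mulr_ge0 ?mulr_ge0 ?exprn_ge0.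
apply: ler_pM; rewrite ?ler_nat//=.
by rewrite subSS; apply: DB => //; exact: ltnW.
Qed.

Lemma iter_mulX_order a b n N D B J : b - a <= 1 -> 0 <= B ->
  (forall r x, (r <= n)%N -> a <= x <= b -> `|D r x| <= B * (b - x) ^+ (N - r)) ->
  exists2 C, 0 <= C & forall i r x, (i <= J)%N -> (r <= n)%N -> a <= x <= b ->
    `|iter i (mulX b) D r x| <= C * (b - x) ^+ (N + i - r).
Proof.
move=> ab B0 DB.
have H i : forall r x, (r <= n)%N -> a <= x <= b ->
    `|iter i (mulX b) D r x| <= n.+1%:R ^+ i * B * (b - x) ^+ (N + i - r).
  elim: i => [|i IH] r x rn xab; first by rewrite expr0 mul1r addn0; exact: DB.
  rewrite iterS addnS exprS -[_ * _ * B]mulrA.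
  by apply: (mulX_order ab) => //; rewrite mulr_ge0 ?exprn_ge0.
exists (n.+1%:R ^+ J * B) => [|i r x iJ rn xab]; first by rewrite mulr_ge0 ?exprn_ge0.
apply: le_trans (H i r x rn xab) _; have /andP[ax xb] := xab.
apply: ler_wpM2r; first by rewrite exprn_ge0 ?subr_ge0.
by apply: ler_wpM2r => //; apply: ler_weXn2l => //; rewrite ler1n.
Qed.

End DerivChain.

(** * Lower bounds for linear combinations of coprime polynomials *)

Section DefectBound.
Context {R : realType}.
Implicit Types (g h G H T W : {poly R}).

(** An injective linear map between finite-dimensional spaces is bounded below. *)
Lemma row_free_bound p q (M : 'M[R]_(p, q)) : row_free M ->
  exists2 K : R, 0 <= K & forall (v : 'rV[R]_p) (b : R), (forall s, `|(v *m M) 0 s| <= b) ->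
    forall r, `|v 0 r| <= K * b.
Proof.
move=> /row_freeP[N MN]; exists (\sum_s \sum_r `|N s r|).
  by apply: sumr_ge0 => s _; apply: sumr_ge0.
move=> v b vb r; rewrite -[v]mulmx1 -MN mulmxA mxE mulr_suml.
apply: le_trans (ler_norm_sum _ _ _) _; apply: ler_sum => s _.
rewrite normrM mulrC; apply: ler_pM => //.
by rewrite (bigD1 r)//= lerDl sumr_ge0.
Qed.

(** For coprime [G] and [H] with [H.[0] != 0], a pair [(g, h)] for which
    [h * G - g * H] and the [e + 1] lowest coefficients of [h] are small has a
    small [h].  Indeed, if all of these vanish then [h = q * H] with
    [size q <= e + 1], and ['X ^ e.+1] divides [q], so that [h = 0] and [g = 0]. *)
Lemma coprime_combination_bound G H i j e N : coprimep G H -> H`_0 != 0 -> G != 0 ->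
  (size H + e)%N = j.+1 -> (i + j + size G + size H <= N)%N ->
  exists2 K : R, 0 <= K & forall g h (b : R), (size g <= i.+1)%N -> (size h <= j.+1)%N ->
    (forall s, `|(h * G - g * H)`_s| <= b) -> (forall s, (s <= e)%N -> `|h`_s| <= b) ->
    forall r, `|h`_r| <= K * b.
Proof.
move=> cGH H0 Gn0 sHe ijN.
pose M := col_mx
  (row_mx (\matrix_(a < i.+1, s < N) - ('X^a * H)`_s) (0 : 'M[R]_(i.+1, e.+1)))
  (row_mx (\matrix_(a < j.+1, s < N) ('X^a * G)`_s)
          (\matrix_(a < j.+1, s < e.+1) ('X^a : {poly R})`_s)).
have ME v1 v2 : row_mx v1 v2 *m M =
  row_mx (\row_s (rVpoly v2 * G - rVpoly v1 * H)`_s) (\row_s (rVpoly v2)`_s).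
  rewrite /M mul_row_col !mul_mx_row add_row_mx mulmx0 add0r; congr row_mx.
    apply/rowP => s; rewrite !mxE !rVpoly_sum !mulr_suml coefB !coef_sum addrC -sumrN.
    by congr (_ + _); apply: eq_bigr => a _; rewrite !mxE -scalerAl coefZ ?mulrN.
  apply/rowP => s; rewrite !mxE rVpoly_sum coef_sum.
  by apply: eq_bigr => a _; rewrite !mxE coefZ.
have /row_free_bound[K K0 KP] : row_free M.
  apply: inj_row_free => v; rewrite -[v]hsubmxK ME.
  set h := rVpoly (rsubmx v); set g := rVpoly (lsubmx v).
  have sg : (size g <= i.+1)%N by rewrite size_poly.
  have sh : (size h <= j.+1)%N by rewrite size_poly.
  rewrite -row_mx0 => /eq_row_mx[/rowP W0 /rowP h0].
  have W : h * G = g * H.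
    apply/eqP; rewrite -subr_eq0 -size_poly_leq0 leqNgt; apply/negP => W.
    have sN : (size (h * G - g * H)%R <= N)%N.
      apply: leq_trans (size_polyD _ _) _; rewrite size_polyN geq_max.
      apply/andP; split; (apply: leq_trans (size_polyMleq _ _) _).
        by move: ijN sh; move: (size G) (size H) (size h) => x y z; clear; lia.
      by move: ijN sg; move: (size G) (size H) (size g) => x y z; clear; lia.
    have sW : ((size (h * G - g * H)%R).-1 < N)%N by rewrite prednK.
    have := W0 (Ordinal sW); rewrite !mxE => /eqP.
    by rewrite -/(lead_coef _) lead_coef_eq0 -size_poly_eq0 -[_ == _]negbK -lt0n W.
  have /dvdpP[q hq] : H %| h.
    by rewrite -(Gauss_dvdpl _ (_ : coprimep H G)) ?W ?dvdp_mulIr// coprimep_sym.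
  have Hn0 : H != 0 by apply: contraNneq H0 => ->; rewrite coef0.
  have q0 : q = 0.
    apply/eqP; apply: contrapT => /negP qn0.
    have : 'X^(e.+1) %| q * H.
      by rewrite -hq; apply/dvdXn_coef => r re; have := h0 (Ordinal re); rewrite !mxE.
    rewrite Gauss_dvdpl ?coprimep_expl//; last first.
      by rewrite -['X]subr0 -polyC0 coprimep_sym coprimep_XsubC rootE horner_coef0.
    move=> /dvdp_leq -/(_ qn0); rewrite size_polyXn.
    have : size h = (size q + size H).-1 by rewrite hq size_mul.
    move: sh sHe; have : (0 < size H)%N by rewrite size_poly_gt0.
    by move: (size h) (size q) (size H) => x y z; clear; lia.
  have hE : h = 0 by rewrite hq q0 mul0r.
  have gE : g = 0.
    by move/eqP: W; rewrite hE mul0r eq_sym mulf_eq0 (negbTE Hn0) orbF => /eqP.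
  have := rVpolyK (rsubmx v); have := rVpolyK (lsubmx v); rewrite -/h -/g hE gE.
  by rewrite !linear0 => <- <-; rewrite row_mx0.
exists K => // g h b sg sh Wb hb r.
have b0 : 0 <= b by apply: le_trans (hb 0%N isT).
have [rj|rj] := ltnP r j.+1; last first.
  by rewrite nth_default ?normr0 ?mulr_ge0//; exact: leq_trans sh rj.
have := KP (row_mx (poly_rV g) (poly_rV h)) b _ (rshift _ (Ordinal rj)).
rewrite ME !poly_rV_K// row_mxEr !mxE /=; apply => s.
case: (split_ordP s) => {}s ->; rewrite ?row_mxEl ?row_mxEr !mxE//.
by apply: hb; rewrite -ltnS.
Qed.

End DefectBound.

(** * Signs of the derivatives of a product *)

Section ProductSigns.
Context {R : realType}.
Implicit Types (D Phi : nat -> R -> R) (h : {poly R}).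

Lemma pmul_scale b h D c r x :
  pmul b h (fun r x => c * D r x) r x = c * pmul b h D r x.
Proof.
have E i : forall r x, iter i (mulX b) (fun r x => c * D r x) r x
    = c * iter i (mulX b) D r x.
  elim: i => [|i IH] // {}r {}x; rewrite !iterS /mulX !IH; ring.
by rewrite /pmul mulr_sumr; apply: eq_bigr => i _; rewrite E mulrCA.
Qed.

Lemma norm_sum_le J (u v : nat -> R) S V : (forall i, (i < J)%N -> `|u i| <= S) ->
  (forall i, (i < J)%N -> `|v i| <= V) ->
  `|\sum_(i < J) u i * v i| <= J%:R * (S * V).
Proof.
move=> uS vV; apply: le_trans (ler_norm_sum _ _ _) _.
apply: (@le_trans _ _ (\sum_(i < J) S * V)); last first.
  by rewrite sumr_const card_ord mulr_natl.
by apply: ler_sum => i _; rewrite normrM; apply: ler_pM => //; [exact: uS|exact: vV].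
Qed.

(** Uniform Taylor bounds for the chains of [(x - 1) ^ i * Phi 0], [i <= J]. *)
Definition iter_bound a n Phi J B :=
  forall i r x, (i <= J)%N -> (r <= n.+1)%N -> a <= x <= 1 ->
    `|iter i (mulX 1) Phi r x| <= B * (1 - x) ^+ (n + i - r).

(** In this section [Phi 0] vanishes to the order [n] at [1], where its [n]-th
    derivative is normalized to [1]. *)
Section Unit.
Variables (a : R) (n : nat) (Phi : nat -> R -> R).
Hypotheses (a1 : a < 1) (a0 : 1 - a <= 1) (cPhi : deriv_chain a 1 n.+1 Phi)
  (Phi_order : forall r, (r < n)%N -> Phi r 1 = 0) (Phin : Phi n 1 = 1).

Lemma iter_bound_ex J : exists2 B, 0 <= B & iter_bound a n Phi J B.
Proof.
have [B0 B00 HB0] := deriv_chain_order (ltW a1) cPhi (leqnSn n) Phi_order.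
exact: iter_mulX_order HB0.
Qed.

Section Bounds.
Variables (J : nat) (B : R) (B0 : 0 <= B) (HB : iter_bound a n Phi J B).

Let X0 x : a <= x <= 1 -> 0 <= 1 - x.
Proof. by case/andP => _ x1; rewrite subr_ge0. Qed.

Let X1 x : a <= x <= 1 -> 1 - x <= 1.
Proof. by case/andP => ax _; apply: le_trans a0; rewrite lerD2l lerN2. Qed.

Lemma lead_bound x : a <= x <= 1 -> `|Phi n x - 1| <= B * (1 - x).
Proof.
move=> xa; have /andP[ax x1] := xa.
have [->|xn1] := eqVneq x 1; first by rewrite Phin subrr normr0 mulr0.
have xl1 : x < 1 by rewrite lt_neqAle xn1.
have [z /andP[xz z1]] := deriv_chain_MVT cPhi (leqnn _) ax xl1 (lexx 1).
rewrite Phin distrC => ->; rewrite normrM (ger0_norm (X0 xa)).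
apply: ler_wpM2r; first exact: X0.
have za : a <= z <= 1 by rewrite (ltW (le_lt_trans ax xz)) ltW.
have := HB (leq0n J) (leqnn n.+1) za.
by rewrite /= addn0 (_ : n - n.+1 = 0)%N ?expr0 ?mulr1//; apply/eqP; rewrite subn_eq0.
Qed.

Lemma next_bound x : a <= x <= 1 -> `|Phi n.+1 x| <= B.
Proof.
move=> xa; have := HB (leq0n J) (leqnn n.+1) xa.
by rewrite /= addn0 (_ : n - n.+1 = 0)%N ?expr0 ?mulr1//; apply/eqP; rewrite subn_eq0.
Qed.

(** The factor [z] is a value of [Phi n], by the mean value theorem. *)
Lemma prev_value x : (0 < n)%N -> a <= x <= 1 -> B * (1 - x) <= 1 / 2 ->
  exists2 z, 1 / 2 <= z & Phi n.-1 x = z * (x - 1).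
Proof.
move=> n0 xa BX; have /andP[ax x1] := xa.
have [->|xn1] := eqVneq x 1.
  by exists 1; [rewrite ler_pdivrMr// mul1r ler1n|rewrite subrr mulr0 Phi_order// prednK].
have xl1 : x < 1 by rewrite lt_neqAle xn1.
have n1n : (n.-1 < n.+1)%N by rewrite ltnS leq_pred.
have [z /andP[xz z1]] := deriv_chain_MVT cPhi n1n ax xl1 (lexx 1).
rewrite Phi_order ?prednK// sub0r => E.
exists (Phi n z); last by rewrite -[LHS]opprK E -mulrN opprB.
have za : a <= z <= 1 by rewrite (ltW (le_lt_trans ax xz)) ltW.
have := lead_bound za; rewrite ler_norml => /andP[+ _].
have : B * (1 - z) <= B * (1 - x) by apply: ler_wpM2l; rewrite // lerD2l lerN2 ltW.
move: BX; move: (B * _) (B * _) (Phi n z) => u v w; lra.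
Qed.

(** Three expansions of derivatives of [h * Phi 0] of orders [n] and [n + 1] near
    [1]; the second one keeps the value [h.[x - 1]], whose sign is known. *)
Lemma pmul_lead h x S : (size h <= J.+1)%N -> (forall r, `|h`_r| <= S) -> a <= x <= 1 ->
  `|pmul 1 h Phi n x - h`_0 * Phi n x| <= J%:R * (S * (B * (1 - x))).
Proof.
move=> sh hS xa; rewrite (pmul_widen _ _ _ _ sh) big_ord_recl /= addrC addKr.
apply: (norm_sum_le (u := fun i => h`_i.+1)
  (v := fun i => iter i.+1 (mulX 1) Phi n x)) => // i iJ.
apply: le_trans (HB iJ (leqnSn _) xa) _; apply: ler_wpM2l => //.
rewrite addnC addnK -[leRHS]expr1; apply: ler_wiXn2l => //; first exact: X0.
exact: X1.
Qed.

Lemma pmul_second h x S : (size h <= J.+1)%N -> (forall r, `|h`_r| <= S) -> a <= x <= 1 ->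
  `|pmul 1 h Phi n x - (h.[x - 1] * Phi n x + n%:R * h`_1 * Phi n.-1 x)|
     <= J%:R * (S * (2 * (B * (1 - x) ^+ 2))).
Proof.
move=> sh hS xa; have sh' := leqW sh.
rewrite (pmul_widen _ _ _ _ sh') (horner_coef_wide _ sh') 2!big_ord_recl.
rewrite [X in _ - (X * _ + _)]big_ord_recl [X in _ - ((_ + X) * _ + _)]big_ord_recl.
rewrite /= /bump /= !add1n expr0 mulr1 expr1 /mulX.
have -> : forall h0 h1 t P Q s s' : R,
    h0 * P + (h1 * (t * P + n%:R * Q) + s) - ((h0 + (h1 * t + s')) * P + n%:R * h1 * Q)
    = s - s' * P.
  by move=> *; ring.
rewrite mulr_suml -sumrB.
have -> : \sum_(i < J) (h`_i.+2 * mulX 1 (mulX 1 (iter i (mulX 1) Phi)) n x -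
      h`_i.+2 * (x - 1) ^+ i.+2 * Phi n x) =
    \sum_(i < J) h`_i.+2 * (iter i.+2 (mulX 1) Phi n x - (x - 1) ^+ i.+2 * Phi n x).
  by apply: eq_bigr => i _; rewrite mulrBr [h`_i.+2 * (_ * Phi n x)]mulrA.
case: J HB sh {sh'} => [|J'] HB' sh; first by rewrite big_ord0 normr0 mulr0n mul0r.
rewrite big_ord_recr /= [h`_J'.+2]nth_default// mul0r addr0.
apply: (@le_trans _ _ (J'%:R * (S * (2 * (B * (1 - x) ^+ 2))))); last first.
  have S0 : 0 <= S by apply: le_trans (hS 0%N).
  apply: ler_wpM2r; last by rewrite ler_nat.
  by do 3?[apply: mulr_ge0 => //]; apply: exprn_ge0; exact: X0.
apply: (norm_sum_le (u := fun i => h`_i.+2)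
  (v := fun i => iter i.+2 (mulX 1) Phi n x - (x - 1) ^+ i.+2 * Phi n x)) => // i iJ.
have XE : (1 - x) ^+ i.+2 <= (1 - x) ^+ 2.
  by apply: ler_wiXn2l => //; [exact: X0|exact: X1].
apply: le_trans (ler_normB _ _) _; rewrite mulr2n mulrDl mul1r; apply: lerD.
  apply: le_trans (HB' i.+2 n x iJ (leqnSn _) xa) _.
  by rewrite addnC addnK; apply: ler_wpM2l.
rewrite normrM normrX distrC (ger0_norm (X0 xa)) mulrC.
apply: ler_pM; rewrite ?exprn_ge0 ?X0//.
by have := HB' 0%N n x isT (leqnSn _) xa; rewrite /= addn0 subnn expr0 mulr1.
Qed.

Lemma pmul_next h x S : (size h <= J.+1)%N -> (forall r, `|h`_r| <= S) -> a <= x <= 1 ->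
  `|pmul 1 h Phi n.+1 x - (h`_0 * Phi n.+1 x
      + h`_1 * ((x - 1) * Phi n.+1 x + n.+1%:R * Phi n x))| <= J%:R * (S * (B * (1 - x))).
Proof.
move=> sh hS xa; rewrite (pmul_widen _ _ _ _ (leqW sh)) 2!big_ord_recl.
rewrite /= /bump /= addrA [_ + \sum_(_ < _) _]addrC addrK.
case: J HB sh => [|J'] HB' sh; first by rewrite big_ord0 normr0 mulr0n mul0r.
rewrite big_ord_recr /= add1n [h`_J'.+2]nth_default// mul0r addr0.
apply: (@le_trans _ _ (J'%:R * (S * (B * (1 - x))))); last first.
  have S0 : 0 <= S by apply: le_trans (hS 0%N).
  apply: ler_wpM2r; last by rewrite ler_nat.
  by do 2?[apply: mulr_ge0 => //]; exact: X0.
apply: (norm_sum_le (u := fun i => h`_i.+2)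
  (v := fun i => iter i.+2 (mulX 1) Phi n.+1 x)) => // i iJ.
apply: le_trans (HB' i.+2 n.+1 x iJ (leqnn _) xa) _; apply: ler_wpM2l => //.
rewrite -[leRHS]expr1; apply: ler_wiXn2l => //; [exact: X0|exact: X1|].
by rewrite subn_gt0 !addnS !ltnS leq_addr.
Qed.

End Bounds.

(** If [h.[0]] dominates the coefficients of [h], then the [n]-th derivative of
    [h * Phi 0] is positive near [1]. *)
Lemma pmul_sign0 K J : 0 <= K ->
  exists2 d, 0 < d & forall h x, (size h <= J.+1)%N -> 0 < h`_0 ->
    (forall r, `|h`_r| <= K * h`_0) -> a <= x <= 1 -> 1 - x < d ->
    0 < pmul 1 h Phi n x.
Proof.
move=> K0; have [B B0 HB] := iter_bound_ex J.
pose q := B + J%:R * (K * B).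
have q0 : 0 <= q by rewrite addr_ge0 ?mulr_ge0.
exists (1 + q)^-1; first by rewrite invr_gt0 ltr_pwDl.
move=> h x sh h0 hK xa xd; have /andP[_ x1] := xa.
have X0 : 0 <= 1 - x by rewrite subr_ge0.
have qX : q * (1 - x) < 1.
  move: xd; rewrite -[X in _ < X]mul1r ltr_pdivlMr ?ltr_pwDl// mulrDr mulr1 mulrC.
  by apply: le_lt_trans; rewrite lerDr.
have := pmul_lead B0 HB sh hK xa; have := lead_bound HB xa.
rewrite !ler_norml => /andP[H1 _] /andP[H2 _].
have H3 : h`_0 * (1 - B * (1 - x)) <= h`_0 * Phi n x.
  apply: ler_wpM2l; first exact: ltW.
  by lra.
have H4 : 0 < h`_0 * (1 - q * (1 - x)) by rewrite mulr_gt0// subr_gt0.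
move: H2 H3 H4; rewrite /q; move: (pmul _ _ _ _ _) (h`_0 * Phi _ _) => u v.
lra.
Qed.

(** The next three facts are about numbers only: [h0] and [h1] stand for the two
    lowest coefficients of [h], [X] and [Y] for distances to [1], [u] and [v] for
    derivatives of [Phi 0] of orders [n] and [n + 1], [n'] for [n] or [n + 1],
    [z] for the factor in [prev_value], [P] for a derivative of [h * Phi 0], and
    the other variables for bounds. *)
Lemma small_constant_term (M h0 T P u bx jx : R) : 0 <= M -> 0 < h0 -> h0 <= T ->
  0 <= bx -> M * (bx + jx) <= 1 -> `|u - 1| <= bx -> `|P - h0 * u| <= jx * T ->
  P <= 0 -> M * h0 <= T.
Proof.
move=> M0 h0p h0T bx0 Mb; rewrite !ler_norml => /andP[u1 _] /andP[P1 _] P0.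
have e1 : h0 * (1 - bx) <= h0 * u by apply: ler_wpM2l; [exact: ltW|lra].
have e2 : h0 * bx <= T * bx by apply: ler_wpM2r.
have e3 : h0 <= (bx + jx) * T.
  by move: P1 P0 e1 e2; move: (h0 * u) => w; lra.
have T0 : 0 <= T by apply: le_trans h0T; exact: ltW.
apply: le_trans (ler_wpM2l M0 e3) _; rewrite mulrA -[leRHS]mul1r.
exact: ler_wpM2r.
Qed.

Lemma positive_slope (h1 hx u n' z X P jx : R) : h1 <= 0 -> 0 < hx -> 1 / 2 <= u ->
  1 <= n' -> 1 / 2 <= z -> 0 <= X -> jx <= 1 / 32 ->
  `|P - (hx * u + n' * h1 * (z * - X))| <= 4 * jx * (X * - h1) -> 0 < P.
Proof.
move=> h1n hx0 u12 n1 z12 X0 jx1; rewrite ler_norml => /andP[P1 _].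
have w0 : 0 <= X * - h1 by rewrite mulr_ge0// oppr_ge0.
have e1 : 0 < hx * u by apply: mulr_gt0 => //; lra.
have e2 : 4 * jx * (X * - h1) <= 1 / 8 * (X * - h1) by apply: ler_wpM2r => //; lra.
have e3 : 1 / 2 * (X * - h1) <= z * (X * - h1) by apply: ler_wpM2r.
have e4 : z * (X * - h1) <= n' * (z * (X * - h1)).
  by rewrite ler_peMl// mulr_ge0//; lra.
have e5 : n' * h1 * (z * - X) = n' * (z * (X * - h1)) by ring.
move: P1; rewrite e5; lra.
Qed.

Lemma positive_next (h0 h1 v n' u Y B P jx : R) : 0 < h0 -> 0 < h1 -> 4 * B * h0 <= h1 ->
  0 <= Y -> `|v| <= B -> 1 <= n' -> `|u - 1| <= B * Y -> B * Y + jx <= 1 / 32 -> 0 <= jx ->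
  `|P - (h0 * v + h1 * (- Y * v + n' * u))| <= 2 * jx * h1 -> 0 < P.
Proof.
move=> h0p h1p h01 Y0; rewrite !ler_norml => /andP[v1 v2] n1 /andP[u1 _] BJ jx0 /andP[P1 _].
have BY0 : 0 <= B * Y by rewrite mulr_ge0//; lra.
have e1 : - (h1 / 4) <= h0 * v.
  have : h0 * - B <= h0 * v by apply: ler_wpM2l => //; exact: ltW.
  lra.
have e2 : h1 * - (B * Y) <= h1 * (- Y * v).
  apply: ler_wpM2l; first exact: ltW.
  by rewrite mulNr lerN2 mulrC; apply: ler_wpM2r.
have u0 : 31 / 32 <= u by lra.
have e3 : h1 * (31 / 32) <= h1 * (n' * u).
  apply: ler_wpM2l; first exact: ltW.
  by apply: le_trans u0 _; rewrite ler_peMl//; lra.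
have e4 : h1 * (B * Y + jx) <= h1 * (1 / 32) by apply: ler_wpM2l => //; exact: ltW.
have e5 : 0 <= h1 * (B * Y) by rewrite mulr_ge0// ltW.
have e6 : 2 * jx * h1 = 2 * (h1 * jx) by ring.
move: P1 e2 e4; rewrite e6 !mulrDr mulrN; lra.
Qed.

(** If the two lowest coefficients of [h] dominate the others, and the [n]-th
    derivative of [h * Phi 0] is nonpositive somewhere near [1], then
    the constant coefficient is small with respect to the linear one; positivity
    of [h] at that point forces the linear coefficient to be positive, and the
    derivative of order [n + 1] is then positive near [1]. *)
Lemma pmul_sign1 K J : (0 < n)%N -> 0 <= K ->
  exists2 d, 0 < d & forall h x y, (size h <= J.+1)%N ->
    (forall r, `|h`_r| <= K * (`|h`_0| + `|h`_1|)) ->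
    a <= x <= 1 -> 1 - x < d -> a <= y <= 1 -> 1 - y < d ->
    0 < h.[x - 1] -> 0 < h`_0 -> pmul 1 h Phi n x <= 0 ->
    0 < pmul 1 h Phi n.+1 y.
Proof.
move=> n0 K0; have [B B0 HB] := iter_bound_ex J.
pose q := B + J%:R * (K * B).
have q0 : 0 <= q by rewrite addr_ge0 ?mulr_ge0.
pose M := 4 * B + 32.
have M32 : 32 <= M by rewrite lerDr mulr_ge0.
have M0 : 0 < M by exact: lt_le_trans M32.
have Mq : 0 < M * (1 + q) by rewrite mulr_gt0// ltr_pwDl.
exists (M * (1 + q))^-1; first by rewrite invr_gt0.
have near z : a <= z <= 1 -> 1 - z < (M * (1 + q))^-1 ->
    [/\ 0 <= 1 - z, 0 <= B * (1 - z), 0 <= J%:R * (K * B) * (1 - z)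
      & M * (B * (1 - z) + J%:R * (K * B) * (1 - z)) <= 1].
  move=> /andP[_ z1] zd; have Z0 : 0 <= 1 - z by rewrite subr_ge0.
  split => //; rewrite ?mulr_ge0//.
  have : (1 - z) * (M * (1 + q)) < 1 by rewrite -ltr_pdivlMr// div1r.
  have -> : (1 - z) * (M * (1 + q)) =
      M * (1 - z) + M * (B * (1 - z) + J%:R * (K * B) * (1 - z)) by rewrite /q; ring.
  by move/ltW; apply: le_trans; rewrite lerDr mulr_ge0// ltW.
move=> h x y sh hK xa xd ya yd hx h0 Px.
have [X0 BX0 JX0 MX] := near x xa xd; have [Y0 BY0 JY0 MY] := near y ya yd.
set S := `|h`_0| + `|h`_1| in hK.
have SE : S = h`_0 + `|h`_1| by rewrite /S gtr0_norm.
have small b j : 0 <= b -> 0 <= j -> M * (b + j) <= 1 -> b + j <= 1 / 32.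
  move=> b0 j0; have : 32 * (b + j) <= M * (b + j) by rewrite ler_wpM2r ?addr_ge0.
  by move: (M * _) => u; lra.
have BX1 := small _ _ BX0 JX0 MX; have BY1 := small _ _ BY0 JY0 MY.
have BX2 : B * (1 - x) <= 1 / 32 by apply: le_trans BX1; rewrite lerDl.
have JX2 : J%:R * (K * B) * (1 - x) <= 1 / 32 by apply: le_trans BX1; rewrite lerDr.
have Mh : M * h`_0 <= S.
  apply: (small_constant_term (ltW M0) h0 _ BX0 MX (lead_bound HB xa) _ Px).
    by rewrite SE lerDl.
  have := pmul_lead B0 HB sh hK xa; congr (_ <= _); ring.
have h01 : 4 * B * h`_0 + 31 * h`_0 <= `|h`_1|.
  by move: Mh; rewrite SE /M; move: (`|_|) => u; lra.
have Bh0 : 0 <= 4 * B * h`_0 by rewrite !mulr_ge0// ltW.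
have S2 : S <= 2 * `|h`_1| by move: h01 Bh0 h0; rewrite SE; move: (`|_|) (4 * B * _) => u v; lra.
have h1n : 0 < `|h`_1| by move: h01 Bh0 h0; move: (`|_|) (4 * B * _) => u v; lra.
have hK2 r : `|h`_r| <= 2 * K * `|h`_1|.
  by apply: le_trans (hK r) _; rewrite -mulrA mulrCA ler_wpM2l.
have h1 : 0 < h`_1.
  rewrite ltNge; apply/negP => h1; suff: 0 < pmul 1 h Phi n x by rewrite ltNge Px.
  have BX3 : B * (1 - x) <= 1 / 2 by apply: le_trans BX2 _; lra.
  have [z z12 zE] := prev_value B0 HB n0 xa BX3.
  have nn : 1 <= n%:R :> R by rewrite ler1n.
  have P12 : 1 / 2 <= Phi n x.
    have := lead_bound HB xa; rewrite ler_norml => /andP[+ _].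
    by move: BX3; move: (B * _) => u; lra.
  apply: (positive_slope h1 hx P12 nn z12 X0 JX2).
  have := pmul_second B0 HB sh hK2 xa; rewrite zE opprB (ler0_norm h1); congr (_ <= _).
  by rewrite expr2; ring.
rewrite gtr0_norm// in h01 hK2.
have Bh1 : 4 * B * h`_0 <= h`_1 by apply: le_trans h01; rewrite lerDl mulr_ge0// ltW.
have nn : 1 <= n.+1%:R :> R by rewrite ler1n.
apply: (positive_next h0 h1 Bh1 Y0 (next_bound HB ya) nn (lead_bound HB ya) BY1 JY0).
have := pmul_next B0 HB sh hK2 ya; rewrite opprB; congr (_ <= _).
ring.
Qed.

End Unit.

End ProductSigns.

(** * Property (P) excludes blocks in the Pade table at 1 *)

Section NoDefect.
Context {R : realType}.
Implicit Types (D : nat -> R -> R) (g h G H T W : {poly R}).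

(** What is used of property (P): on each interval [[x, 1]] with [a <= x] and for
    each type [(i, j)] there are [g] and [h] of degrees at most [i] and [j], in the
    variable [z - 1], with [h > 0] on the interval, such that [h * f - g] has alternating
    signs at [i + j + 2] points, the first sign being negative. *)
Definition alternating_approximants (a : R) (f : R -> R) :=
  forall i j (x : R), a <= x < 1 -> exists g h,
    [/\ (size g <= i.+1)%N, (size h <= j.+1)%N,
        forall z, x <= z <= 1 -> 0 < h.[z - 1]
      & alternates x 1 (i + j + 1) (-1) (fun z => h.[z - 1] * f z - g.[z - 1])].

Lemma horner_pos_near (p : {poly R}) : 0 < p`_0 ->
  exists2 d, 0 < d & forall x, x <= 1 -> 1 - x < d -> 0 < p.[x - 1].
Proof.
move=> p0; have p00 : 0 < p.[0] by rewrite horner_coef0.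
have /cvgrPdist_lt/(_ _ p00)/nbhs_ballP[d d0 dp] := @continuous_horner R p 0.
exists d => // x x1 xd; have /= := dp (x - 1).
rewrite /ball /= sub0r normrN ler0_norm; last by lra.
rewrite opprB => /(_ xd); move: (p.[x - 1]) (p.[0]) => u v.
by rewrite ltr_norml => /andP[_]; lra.
Qed.

Lemma alternates_eq a b k s (u v : R -> R) :
  (forall x, a <= x <= b -> u x = v x) -> alternates a b k s u -> alternates a b k s v.
Proof.
move=> uv [y [yab yinc ys]]; exists y; split => // j jk.
by rewrite -uv; [exact: ys|exact: yab].
Qed.

Lemma alternates_mul a b k s (u v : R -> R) :
  (forall x, a <= x <= b -> 0 < v x) -> alternates a b k s u ->
  alternates a b k s (fun x => v x * u x).
Proof.
move=> v0 [y [yab yinc ys]]; exists y; split => // j jk.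
by rewrite mulrCA mulr_gt0// ?v0 ?yab// ys.
Qed.

Lemma alternates_signs a b k (s : R) (u : R -> R) : alternates a b k.+1 s u ->
  (exists2 x, a <= x <= b & u x <= 0) /\ (exists2 x, a <= x <= b & 0 <= u x).
Proof.
move=> [y [yab _ ys]].
have := ys 0%N isT; have := ys 1%N isT; rewrite expr0 expr1 mulr1 mulrN1.
have y0 := yab 0%N isT; have y1 := yab 1%N isT.
have [s0|s0|->] := ltgtP s 0; last by rewrite oppr0 mul0r ltxx.
- rewrite pmulr_rgt0 ?oppr_gt0// nmulr_rgt0// => /ltW u1 /ltW u0.
  by split; [exists (y 0%N)|exists (y 1%N)].
- rewrite nmulr_rgt0 ?oppr_lt0// pmulr_rgt0// => /ltW u1 /ltW u0.
  by split; [exists (y 1%N)|exists (y 0%N)].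
Qed.

(** In this section [G / H] is a fraction that approximates [f = D 0] to the order
    [n] at [1], and [F] is the chain of [H * f - G]. *)
Section Chain.
Variables (a : R) (n : nat) (D : nat -> R -> R) (T G H : {poly R}).
Hypotheses (a1 : a < 1) (a0 : 1 - a <= 1) (cD : deriv_chain a 1 n.+1 D)
  (jD : jet 1 n.+1 D T) (aD : alternating_approximants a (D 0%N))
  (cGH : coprimep G H) (H0 : 0 < H`_0) (Gn0 : G != 0)
  (sGH : (size G + size H <= n)%N)
  (ord : forall r, (r < n)%N -> (H * T - G)`_r = 0).

Let F r x := 1 * pmul 1 H D r x + (-1) * pmul 1 G one_chain r x.

Let cF : deriv_chain a 1 n.+1 F.
Proof.
apply: deriv_chain_lin; first exact: deriv_chain_pmul.
exact/deriv_chain_pmul/deriv_chain_one.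
Qed.

Let F1 r : (r <= n.+1)%N -> F r 1 = (H * T - G)`_r * r`!%:R.
Proof.
move=> rn; rewrite /F (jet_pmul H jD)// (jet_pmul G (@jet_one R 1 n.+1))// mulr1 coefB.
ring.
Qed.

Let F_order r : (r < n)%N -> F r 1 = 0.
Proof. by move=> rn; have /F1-> := leqW (ltnW rn); rewrite (ord rn) mul0r. Qed.

(** The approximants of type [(n - size H, size H - 1 + e)] on small intervals
    [[x, 1]] have a denominator [h] that is dominated by its [e + 1] lowest
    coefficients, and the [n]-th derivative of [h * F] still alternates [e]
    times.  Both follow from the identity [H (h f - g) = h F + W], where the
    polynomial [W = h G - g H] has degree less than [n]: it disappears after [n]
    differentiations, and its coefficients are small because the lower
    derivatives of [h F] are small while those of [h F + W] change sign. *)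
Lemma defect_denominators e : (e <= 1)%N ->
  exists2 K, 0 <= K & exists2 d, 0 < d & forall x, a <= x < 1 -> 1 - x < d ->
    exists h, [/\ (size h <= size H + e)%N, forall z, x <= z <= 1 -> 0 < h.[z - 1],
      forall r, `|h`_r| <= K * \sum_(s < e.+1) `|h`_s|
    & alternates x 1 e (- (-1) ^+ n) (pmul 1 h F n)].
Proof.
move=> e1.
have a00 : 0 <= a by rewrite -(gerBl 1).
have sG0 : (0 < size G)%N by rewrite size_poly_gt0.
have Hn0 : H != 0 by apply: contraTneq H0 => ->; rewrite coef0 ltxx.
have sH0 : (0 < size H)%N by rewrite size_poly_gt0.
pose i := (n - size H)%N; pose j := ((size H).-1 + e)%N.
have sHe : (size H + e)%N = j.+1 by rewrite /j -addSn prednK.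
have ijn : (i + j + 1 = e + n)%N.
  rewrite /i /j; move: sH0 sG0 sGH; move: (size H) (size G) => b c; clear; lia.
have H0' : H`_0 != 0 by rewrite gt_eqF.
have [K0 K00 KP] := coprime_combination_bound cGH H0' Gn0 sHe (leqnn (i + j + size G + size H)).
have [B1 B10 HB1] := deriv_chain_order (ltW a1) cF (leqnSn n) F_order.
have [B B0 HB] := iter_mulX_order j a0 B10 HB1.
have [d1 d10 Hpos] := horner_pos_near H0.
pose q := j.+1%:R * K0 * (n%:R * B).
have q0 : 0 <= q by rewrite !mulr_ge0.
exists (2 * j.+1%:R * K0); first by rewrite !mulr_ge0.
exists (Num.min d1 (2 * (1 + q))^-1).
  by rewrite lt_min d10 invr_gt0 mulr_gt0// ltr_pwDl.
move=> x /andP[ax x1]; rewrite lt_min => /andP[xd1 xq].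
have qx : q * (1 - x) <= 1 / 2.
  move: xq; rewrite -[X in _ < X]mul1r ltr_pdivlMr ?mulr_gt0 ?ltr_pwDl// => xq.
  have : 0 < 1 - x by rewrite subr_gt0.
  lra.
have xa : a <= x < 1 by rewrite ax.
have [g [h [sg sh hpos halt]]] := aD i j xa.
pose W := h * G - g * H.
pose Psi r z := 1 * pmul 1 h F r z + 1 * pmul 1 W one_chain r z.
have cFx : deriv_chain x 1 n F by apply: deriv_chain_sub cF.
have cW : deriv_chain x 1 n (pmul 1 W one_chain).
  exact/deriv_chain_pmul/deriv_chain_one.
have cPsi : deriv_chain x 1 n Psi.
  by apply: deriv_chain_lin => //; exact: deriv_chain_pmul.
have Psi0 z : H.[z - 1] * (h.[z - 1] * D 0%N z - g.[z - 1]) = Psi 0%N z.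
  rewrite /Psi !pmul0 /F !pmul0 /W hornerD hornerN !hornerM /one_chain /=; ring.
have altPsi r : (r <= n)%N -> alternates x 1 (e + n - r) ((-1) ^+ r * -1) (Psi r).
  move=> rn; apply: (alternates_iter cPsi rn).
  rewrite subnK; last by rewrite (leq_trans rn)// leq_addl.
  apply: (alternates_eq (u := fun z => H.[z - 1] * (h.[z - 1] * D 0%N z - g.[z - 1]))).
    by move=> z _; exact: Psi0.
  rewrite -ijn; apply: alternates_mul => // z /andP[xz z1]; apply: Hpos => //.
  by apply: le_lt_trans xd1; rewrite lerD2l lerN2.
have sW : (size W <= n)%N.
  apply: leq_trans (size_polyD _ _) _; rewrite size_polyN geq_max.
  apply/andP; split; (apply: leq_trans (size_polyMleq _ _) _).
    by move: sh sHe e1 sGH sG0; move: (size G) (size H) (size h) => b c d; clear; lia.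
  by move: sg sH0 sG0 sGH; rewrite /i; move: (size G) (size H) (size g) => b c d; clear; lia.
have altn : alternates x 1 e (- (-1) ^+ n) (pmul 1 h F n).
  have := altPsi n (leqnn _); rewrite addnK mulrN1; apply: alternates_eq => z _.
  by rewrite /Psi (pmul_one_eq0 _ _ sW) mulr0 addr0 mul1r.
suff hK r : `|h`_r| <= 2 * j.+1%:R * K0 * \sum_(s < e.+1) `|h`_s| by exists h; rewrite sHe; split.
pose S := \sum_(s < j.+1) `|h`_s|; pose S0 := \sum_(s < e.+1) `|h`_s|.
have S_ge0 : 0 <= S by apply: sumr_ge0.
have S0_ge0 : 0 <= S0 by apply: sumr_ge0.
have rS s : `|h`_s| <= S.
  have [sj|sj] := ltnP s j.+1; last by rewrite nth_default ?normr0//; exact: leq_trans sh sj.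
  by rewrite /S (bigD1 (Ordinal sj))//= lerDl sumr_ge0.
have x0 : 0 <= 1 - x by rewrite subr_ge0 ltW.
have hF r' z : (r' < n)%N -> x <= z <= 1 -> `|pmul 1 h F r' z| <= S * (B * (1 - x)).
  move=> rn /andP[xz z1]; rewrite (pmul_widen _ _ _ _ sh).
  apply: le_trans (ler_norm_sum _ _ _) _; rewrite mulr_suml; apply: ler_sum => s _.
  have az' : a <= z by rewrite (le_trans ax xz).
  have az : a <= z <= 1 by rewrite az'.
  rewrite normrM; apply: ler_wpM2l => //.
  have sj : (s <= j)%N by rewrite -ltnS.
  apply: le_trans (HB s r' z sj (ltnW (leqW rn)) az) _; apply: ler_wpM2l => //.
  apply: (@le_trans _ _ (1 - z)); last by rewrite lerD2l lerN2.
  have z0 : 0 <= 1 - z by rewrite subr_ge0.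
  rewrite -[leRHS]expr1; apply: ler_wiXn2l => //; last by rewrite subn_gt0 ltn_addr.
  by rewrite gerBl (le_trans a00).
have Bx0 : 0 <= S * (B * (1 - x)) by rewrite !mulr_ge0.
have Wsmall r' z : (r' <= n)%N -> x <= z <= 1 ->
    `|pmul 1 W one_chain r' z| <= (n - r')%:R * (S * (B * (1 - x))).
  apply: deriv_chain_small => //; first by rewrite gerBl (le_trans a00).
    by move=> y _; exact: pmul_one_eq0.
  move=> r1 r1n.
  have [|[y yx Py] [y' yx' Py']] := @alternates_signs x 1 (e + n - r1).-1 ((-1) ^+ r1 * -1) (Psi r1).
    rewrite prednK; first exact: altPsi (ltnW r1n).
      by rewrite subn_gt0 ltn_addl.
  split; [exists y => //|exists y' => //].
    by have := hF r1 y r1n yx; move: Py; rewrite /Psi !mul1r ler_norml => ? /andP[]; lra.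
  by have := hF r1 y' r1n yx'; move: Py'; rewrite /Psi !mul1r ler_norml => ? /andP[]; lra.
have Wcoef s : `|W`_s| <= n%:R * (S * (B * (1 - x))).
  have [sn|sn] := ltnP s n; last first.
    by rewrite nth_default ?normr0 ?mulr_ge0//; exact: leq_trans sW sn.
  have x11 : x <= (1 : R) <= 1 by rewrite ltW//=.
  have := Wsmall s 1 (ltnW sn) x11.
  rewrite (jet_pmul W (@jet_one R 1 n))// ?(ltnW sn)// mulr1 normrM normr_nat => Ws.
  apply: (@le_trans _ _ (`|W`_s| * s`!%:R)).
    by rewrite ler_peMr// ler1n fact_gt0.
  by apply: le_trans Ws _; rewrite ler_wpM2r// ler_nat leq_subr.
pose b := n%:R * (S * (B * (1 - x))) + S0.
have hb s : `|h`_s| <= K0 * b.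
  apply: (KP g h b sg sh) => [{}s|{}s se].
    by apply: le_trans (Wcoef s) _; rewrite lerDl.
  have se' : (s < e.+1)%N by [].
  apply: (@le_trans _ _ S0); last by rewrite lerDr mulr_ge0.
  by rewrite /S0 (bigD1 (Ordinal se'))//= lerDl sumr_ge0.
have Sb : S <= j.+1%:R * (K0 * b).
  apply: (@le_trans _ _ (\sum_(s < j.+1) K0 * b)); first by apply: ler_sum.
  by rewrite sumr_const card_ord mulr_natl.
have SS : S <= 2 * j.+1%:R * K0 * S0.
  have qS : (q * (1 - x)) * S <= 1 / 2 * S by apply: ler_wpM2r.
  have bE : j.+1%:R * (K0 * b) = (q * (1 - x)) * S + j.+1%:R * K0 * S0.
    by rewrite /b /q; ring.
  move: Sb; rewrite bE; lra.
exact: le_trans (rS r) SS.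
Qed.

Let C := F n 1.

Hypothesis C0 : C != 0.

Let Phi r x := C^-1 * F r x.

Let cPhi : deriv_chain a 1 n.+1 Phi.
Proof.
have := deriv_chain_lin C^-1 0 cF cF.
by under eq_fun do under eq_fun do rewrite mul0r addr0.
Qed.

Let Phi_order r : (r < n)%N -> Phi r 1 = 0.
Proof. by move=> rn; rewrite /Phi F_order ?mulr0. Qed.

Let Phin : Phi n 1 = 1.
Proof. by rewrite /Phi mulVf. Qed.

Let pmulF h r x : pmul 1 h F r x = C * pmul 1 h Phi r x.
Proof. by rewrite /Phi pmul_scale mulrA divff// mul1r. Qed.

(** The sign of [C], read off from the type [(n - size H, size H - 1)]. *)
Lemma defect_sign0 : 0 < - (-1) ^+ n * C.
Proof.
have [K K0 [d d0 HK]] := defect_denominators (leq0n 1).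
have [d' d0' Hs] := pmul_sign0 a1 a0 cPhi Phi_order Phin (size H) K0.
pose x := Num.max a (1 - Num.min d d' / 2).
have m0 : 0 < Num.min d d' by rewrite lt_min d0.
have xa : a <= x < 1 by rewrite le_max lexx /= gt_max a1; lra.
have xm : 1 - x < Num.min d d'.
  have : 1 - Num.min d d' / 2 <= x by rewrite le_max lexx orbT.
  lra.
move: xm; rewrite lt_min => /andP[xd xd'].
have [h [sh hpos hK [y [yx _ ys]]]] := HK x xa xd.
have h0 : 0 < h`_0.
  have := hpos 1; rewrite subrr horner_coef0; apply.
  by case/andP: xa => _ /ltW->/=.
have := ys 0%N isT; rewrite expr0 mulr1 pmulF mulrA pmulr_lgt0//.
have /andP[xy y1] := yx 0%N isT; have /andP[ax _] := xa.
apply: Hs => //.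
- by rewrite (leq_trans sh)// addn0.
- by move=> r; have := hK r; rewrite big_ord1 (gtr0_norm h0).
- by rewrite (le_trans ax xy).
- by apply: le_lt_trans xd'; rewrite lerD2l lerN2.
Qed.

(** The opposite sign, read off from the type [(n - size H, size H)]. *)
Lemma defect_sign1 : 0 < (-1) ^+ n * C.
Proof.
have [K K0 [d d0 HK]] := defect_denominators (leqnn 1).
have sG0 : (0 < size G)%N by rewrite size_poly_gt0.
have n0 : (0 < n)%N by apply: leq_trans sGH; rewrite addn_gt0 sG0.
have [d' d0' Hs] := pmul_sign1 a1 a0 cPhi Phi_order Phin (size H) n0 K0.
pose x := Num.max a (1 - Num.min d d' / 2).
have m0 : 0 < Num.min d d' by rewrite lt_min d0.
have xa : a <= x < 1 by rewrite le_max lexx /= gt_max a1; lra.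
have xm : 1 - x < Num.min d d'.
  have : 1 - Num.min d d' / 2 <= x by rewrite le_max lexx orbT.
  lra.
move: xm; rewrite lt_min => /andP[xd xd'].
have [h [sh hpos hK halt]] := HK x xa xd.
have h0 : 0 < h`_0.
  have := hpos 1; rewrite subrr horner_coef0; apply.
  by case/andP: xa => _ /ltW->/=.
have /andP[ax _] := xa.
have near z : x <= z <= 1 -> a <= z <= 1 /\ 1 - z < d'.
  move=> /andP[xz z1]; rewrite (le_trans ax xz) z1; split => //.
  by apply: le_lt_trans xd'; rewrite lerD2l lerN2.
have halt' : alternates x 1 1 (- (-1) ^+ n * C) (pmul 1 h Phi n).
  case: halt => y [y1 y2 ys]; exists y; split => // i ik.
  by have := ys i ik; rewrite pmulF; congr (0 < _); ring.
have [[z zx Pz] _] := alternates_signs halt'.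
have cFx : deriv_chain x 1 n.+1 (pmul 1 h F).
  by apply: deriv_chain_sub (deriv_chain_pmul h cF).
have [y [yx _ ys]] := alternates_deriv cFx (leqnn _) halt.
have := ys 0%N isT; rewrite expr0 mulr1 opprK pmulF mulrA pmulr_lgt0//.
have [za zd] := near _ zx; have [ya yd] := near _ (yx 0%N isT).
apply: (Hs h z) => //.
- by rewrite (leq_trans sh)// addn1.
- by move=> r; have := hK r; rewrite big_ord_recl big_ord1.
- exact: hpos.
Qed.

End Chain.

(** The Pade table of [f] at [1] has no block of size larger than one, as far as
    the smoothness of [f] allows to see it. *)
Lemma no_pade_defect a n D T G H : a < 1 -> 1 - a <= 1 ->
  deriv_chain a 1 n.+1 D -> jet 1 n.+1 D T -> alternating_approximants a (D 0%N) ->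
  coprimep G H -> H`_0 != 0 -> G != 0 -> (size G + size H <= n)%N ->
  (forall r, (r < n)%N -> (H * T - G)`_r = 0) -> (H * T - G)`_n = 0.
Proof.
move=> a1 a0 cD jD aD.
wlog H0 : G H / 0 < H`_0.
  move=> wl cGH Hn0 Gn0 sGH ord; have [H0|H0] := ltP 0 H`_0; first exact: (wl G H).
  have E : (- H) * T - (- G) = - (H * T - G) by rewrite mulNr opprB opprK addrC.
  have cGH' : coprimep (- G) (- H).
    by rewrite -(scaleN1r G) -(scaleN1r H) coprimepZl ?coprimepZr ?oppr_eq0 ?oner_eq0.
  have := wl (- G) (- H); rewrite E !coefN !oppr_eq0 !size_polyN oppr_gt0.
  rewrite lt_neqAle Hn0 H0 => /(_ isT cGH' isT Gn0 sGH) wl'.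
  apply/eqP; rewrite -oppr_eq0 wl'// => r rn.
  by rewrite coefN ord// oppr0.
move=> cGH _ Gn0 sGH ord; apply/eqP; apply: contrapT => /negP Fn0.
pose F r x := 1 * pmul 1 H D r x + (-1) * pmul 1 G one_chain r x.
have C0 : F n 1 != 0.
  rewrite /F (jet_pmul H jD)// (jet_pmul G (@jet_one R 1 n))// mulr1 mul1r mulN1r -mulrBl -coefB.
  by rewrite mulf_neq0// pnatr_eq0 -lt0n fact_gt0.
have s0 : 0 < - (-1) ^+ n * F n 1 := defect_sign0 a1 a0 cD jD aD cGH H0 Gn0 sGH ord C0.
have s1 : 0 < (-1) ^+ n * F n 1 := defect_sign1 a1 a0 cD jD aD cGH H0 Gn0 sGH ord C0.
move: (F n 1) s0 s1 => c; rewrite mulNr oppr_gt0 => s0 s1.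
by have := lt_trans s0 s1; rewrite ltxx.
Qed.

End NoDefect.

(** * Smooth functions and their Pade approximants *)

Section ClassC.
Context {R : realType}.

Lemma within_dnbhs_cvgP (A : set R) (x l : R) (q : R -> R) :
  q @ within A x^' --> l ->
  forall e, 0 < e -> exists2 d, 0 < d &
    forall y, A y -> y != x -> `|x - y| < d -> `|l - q y| < e.
Proof.
move=> /cvgrPdist_lt ql e e0; have := ql e e0.
rewrite /within /= /dnbhs => /nbhs_ballP[d /= d0 dq].
by exists d => // y Ay yx xy; apply: (dq y).
Qed.

Lemma within_continuousP (A : set R) (u : R -> R) :
  {within A, continuous u} <-> forall x, A x -> forall e, 0 < e ->
    exists2 d, 0 < d & forall y, A y -> `|x - y| < d -> `|u x - u y| < e.
Proof.
split => [/subspace_continuousP cu x Ax e e0|cu].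
  have /cvgrPdist_lt/(_ _ e0) := cu x Ax.
  rewrite /within /= => /nbhs_ballP[d /= d0 dq].
  by exists d => // y Ay xy; apply: (dq y).
apply/subspace_continuousP => x Ax; apply/cvgrPdist_lt => e e0.
have [d d0 dq] := cu x Ax e e0; rewrite /within /=; apply/nbhs_ballP.
by exists d => // y /= xy Ay; exact: dq.
Qed.

Lemma class_C_chain a b n (F : R -> R) : class_C n `[a, b] F ->
  exists2 D, D 0%N = F & deriv_chain a b n D.
Proof.
elim: n F => [|n IH] F /=.
  by move=> cF; exists (fun=> F) => //; split => // -[].
move=> [F' [FF' /IH[D D0 [cD dD]]]].
exists (fun r => if r is r'.+1 then D r' else F) => //; split.
  case=> [|r rn]; last exact: cD.
  move=> _; apply/within_continuousP => x Ax e e0.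
  have [d d0 dq] := within_dnbhs_cvgP (FF' x Ax) ltr01.
  pose M := `|F' x| + 1; have M0 : 0 < M by rewrite ltr_wpDl.
  exists (Num.min d (e / M)); first by rewrite lt_min d0 divr_gt0.
  move=> y Ay; rewrite lt_min => /andP[yd ye].
  have [->|yx] := eqVneq y x; first by rewrite subrr normr0.
  have := dq y Ay yx yd; set Q := (_ / _) => FQ.
  have QM : `|Q| < M.
    have := ler_normD (Q - F' x) (F' x); rewrite subrK distrC /M.
    by move: FQ; rewrite /= -/Q; lra.
  have -> : F x - F y = Q * (x - y).
    by rewrite /Q -[x - y]opprB mulrN divfK ?subr_eq0// opprB.
  rewrite normrM; apply: le_lt_trans (_ : M * `|x - y| < e).
    by apply: ler_wpM2r => //; exact: ltW.
  by move: ye; rewrite ltr_pdivlMr// mulrC.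
case=> [|r] x rn /andP[ax xb] /=; last by apply: dD => //; rewrite ax.
rewrite D0; have Ax : `[a, b]%classic x by rewrite /= in_itv /= !ltW.
apply/is_derive1_caratheodory.
exists (fun z => if z == x then F' x else (F z - F x) / (z - x)); split.
- move=> z; have [->|zx] := eqVneq z x; first by rewrite !subrr mulr0.
  by rewrite divfK// subr_eq0.
- apply/cvgrPdist_lt => e e0.
  have [d d0 dq] := within_dnbhs_cvgP (FF' x Ax) e0.
  apply/nbhs_ballP; exists (Num.min d (Num.min (x - a) (b - x))) => /=.
    by rewrite !lt_min d0 !subr_gt0 ax.
  move=> y; rewrite /ball /= !lt_min => /andP[yd /andP[y1 y2]]; rewrite eqxx.
  have [_|yx] := eqVneq y x; first by rewrite subrr normr0.
  apply: dq => //; rewrite /= in_itv /=; move: y1 y2; rewrite !ltr_norml.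
  by move=> /andP[_ ?] /andP[? _]; apply/andP; split; lra.
- by rewrite eqxx.
Qed.

(** The [(m, l)] Pade approximant at [1] of a function of class [C^(m+l+1)]. *)
Lemma pade_approximation a m l D : a < 1 -> 1 - a <= 1 ->
  deriv_chain a 1 (m + l + 1) D -> alternating_approximants a (D 0%N) ->
  D 0%N 1 != 0 ->
  exists (g h : {poly R}) B, [/\ (size g <= m.+1)%N, (size h <= l.+1)%N, coprimep g h,
    h`_0 != 0 & forall x, a <= x <= 1 ->
      `|h.[x - 1] * D 0%N x - g.[x - 1]| <= B * (1 - x) ^+ (m + l + 1)].
Proof.
move=> a1 a0 cD aD D0; set p := (m + l + 1)%N in cD *.
pose T := \poly_(r < p.+1) (D r 1 / r`!%:R).
have jT : jet 1 p D T.
  by move=> r rp; rewrite coef_poly ltnS rp divfK// pnatr_eq0 -lt0n fact_gt0.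
have T0 : T`_0 != 0 by rewrite coef_poly /= fact0 divr1.
have [[g [h [sg sh h0 cgh hT]]]|] := pade_or_defect m l T0.
  pose E r x := 1 * pmul 1 h D r x + (-1) * pmul 1 g one_chain r x.
  have cE : deriv_chain a 1 p E.
    apply: deriv_chain_lin; first exact: deriv_chain_pmul.
    exact/deriv_chain_pmul/deriv_chain_one.
  have E0 r : (r < p)%N -> E r 1 = 0.
    move=> rp; rewrite /E (jet_pmul h jT (ltnW rp)).
    rewrite (jet_pmul g (@jet_one R 1 p) (ltnW rp)) mulr1 mul1r mulN1r -mulrBl -coefB.
    by rewrite hT ?mul0r//; move: rp; rewrite /p addn1.
  have [B B0 HB] := deriv_chain_order (ltW a1) cE (leqnn p) E0.
  exists g, h, B; split => // x xa.
  by have := HB 0%N x isT xa; rewrite /E !pmul0 /one_chain /= mulr1 mul1r mulN1r subn0.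
move=> [G [H [n [cGH H0 Gn0 /andP[sGH nml] [ord]]]]].
have np : (n.+1 <= p)%N by rewrite /p addn1.
rewrite (no_pade_defect a1 a0 _ _ aD cGH H0 Gn0 sGH ord) ?eqxx//.
  exact: deriv_chain_sub (lexx a) np cD.
by move=> r rn; apply: jT; exact: leq_trans rn np.
Qed.

End ClassC.

(** * Polynomials on an interval, maximum norms, the inverse of f *)

Section PolyInterval.
Context {R : realType}.

Lemma poly_eq0_itv (p : {poly R}) (a b : R) : a < b ->
  (forall x, a < x < b -> p.[x] = 0) -> p = 0.
Proof.
move=> ab p0; apply/eqP; apply: contraTT isT => pn0.
pose s := [seq a + (b - a) * (k.+1%:R / (size p).+1%:R) | k <- iota 0 (size p)].
have := @max_poly_roots _ p s pn0.
rewrite size_map size_iota ltnn => H; apply: H.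
  apply/allP => x /mapP[k]; rewrite mem_iota add0n => /andP[_ kp] ->.
  apply/rootP/p0.
  have k0 : 0 < k.+1%:R / (size p).+1%:R :> R by rewrite divr_gt0.
  have k1 : k.+1%:R / (size p).+1%:R < 1 :> R.
    by rewrite ltr_pdivrMr// mul1r ltr_nat ltnS.
  by rewrite ltrDl mulr_gt0 ?subr_gt0//= -ltrBrDl gtr_pMr ?subr_gt0.
rewrite map_inj_uniq ?iota_uniq// => k1 k2 /addrI.
have ba : b - a != 0 by rewrite subr_eq0 gt_eqF.
have s0 : (size p).+1%:R^-1 != 0 :> R by rewrite invr_eq0 pnatr_eq0.
by move=> /(mulfI ba)/(mulIf s0)/eqP; rewrite eqr_nat eqSS => /eqP.
Qed.

End PolyInterval.

Section Maxnorm.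
Context {R : realType}.
Implicit Types (S : set R) (g : R -> R).

Lemma maxnorm_le S g M : (forall z, S z -> `|g z| <= M) -> (maxnorm S g <= M%:E)%E.
Proof. by move=> gM; apply: ge_ereal_sup => _ [z Sz <-]; rewrite lee_fin gM. Qed.

Lemma le_maxnorm S g z : S z -> (`|g z|%:E <= maxnorm S g)%E.
Proof. by move=> Sz; apply: ereal_sup_ubound; exists z. Qed.

Lemma maxnorm_attained S g M z : (forall z, S z -> `|g z| <= M) -> S z -> `|g z| = M ->
  maxnorm S g = M%:E.
Proof.
move=> gM Sz gz; apply/eqP; rewrite eq_le maxnorm_le//=.
by rewrite -gz; exact: le_maxnorm.
Qed.

End Maxnorm.

Section Inv01.
Context {R : realType} (f : R -> R) (hf : incr_bij01 f).

Let fc : {within `[0, 1], continuous f}. Proof. by case: hf. Qed.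

Lemma incr_bij01_itv x : 0 <= x <= 1 -> 0 <= f x <= 1.
Proof.
case: hf => _ _ [ff _ _] x01; have := ff x; rewrite /= !in_itv /=; exact.
Qed.

Lemma inv01_itv y : 0 <= y <= 1 -> 0 <= inv01 f y <= 1.
Proof.
case: hf => _ _ [_ _ fs] y01.
have := @surjpinv_image_sub _ _ (fun=> 0) `[0, 1]%classic `[0, 1]%classic f fs.
move/(_ (inv01 f y)); by rewrite /= in_itv /=; apply; exists y.
Qed.

Lemma f_inv01 y : 0 <= y <= 1 -> f (inv01 f y) = y.
Proof.
case: hf => _ _ [_ _ fs] y01.
by rewrite (surjpK _ fs)// inE /= in_itv.
Qed.

Lemma incr_bij01_lt x y : 0 <= x -> x < y -> y <= 1 -> f x < f y.
Proof.
case: hf => _ fi _ x0 xy y1; apply: fi => //; rewrite in_itv /=.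
  by rewrite x0 (le_trans (ltW xy)).
by rewrite y1 (le_trans x0 (ltW xy)).
Qed.

Lemma incr_bij01_le x y : 0 <= x -> x <= y -> y <= 1 -> f x <= f y.
Proof.
move=> x0; rewrite le_eqVlt => /orP[/eqP->//|xy] y1.
by rewrite ltW// incr_bij01_lt.
Qed.

Lemma inv01_f x : 0 <= x <= 1 -> inv01 f (f x) = x.
Proof.
move=> x01; have fx := incr_bij01_itv x01; have /andP[i0 i1] := inv01_itv fx.
have /andP[x0 x1] := x01.
have := f_inv01 fx; have [h|h|//] := ltgtP (inv01 f (f x)) x => E.
  by have := incr_bij01_lt i0 h x1; rewrite E ltxx.
by have := incr_bij01_lt x0 h i1; rewrite E ltxx.
Qed.

Lemma inv01_lt x y : 0 <= x -> x < y -> y <= 1 -> inv01 f x < inv01 f y.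
Proof.
move=> x0 xy y1.
have x01 : 0 <= x <= 1 by rewrite x0 ltW// (lt_le_trans xy).
have y01 : 0 <= y <= 1 by rewrite y1 ltW// (le_lt_trans x0).
have /andP[ix0 ix1] := inv01_itv x01; have /andP[iy0 iy1] := inv01_itv y01.
rewrite ltNge; apply/negP => /(incr_bij01_le iy0)/(_ ix1).
by rewrite !f_inv01// leNgt xy.
Qed.

Lemma inv01_le x y : 0 <= x -> x <= y -> y <= 1 -> inv01 f x <= inv01 f y.
Proof.
move=> x0; rewrite le_eqVlt => /orP[/eqP->//|xy] y1.
by rewrite ltW// inv01_lt.
Qed.

Lemma incr_bij01_0 : f 0 = 0.
Proof.
have h0 : 0 <= (0 : R) <= 1 by rewrite lexx ler01.
have /andP[i0 i1] := inv01_itv h0.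
apply/eqP; rewrite eq_le; have /andP[-> _] := incr_bij01_itv h0; rewrite andbT.
by rewrite -[leRHS](f_inv01 h0) incr_bij01_le.
Qed.

Lemma incr_bij01_1 : f 1 = 1.
Proof.
have h1 : 0 <= (1 : R) <= 1 by rewrite lexx ler01.
have /andP[i0 i1] := inv01_itv h1.
apply/eqP; rewrite eq_le; have /andP[_ ->] := incr_bij01_itv h1.
by rewrite -[leLHS](f_inv01 h1) incr_bij01_le.
Qed.

Lemma inv01_1 : inv01 f 1 = 1.
Proof. by rewrite -[in LHS]incr_bij01_1 inv01_f ?ler01 ?lexx. Qed.

Lemma inv01_0 : inv01 f 0 = 0.
Proof. by rewrite -[in LHS]incr_bij01_0 inv01_f ?ler01 ?lexx. Qed.

Lemma inv01_oo a : 0 < a < 1 -> 0 < inv01 f a < 1.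
Proof.
move=> /andP[a0 a1]; rewrite -{1}inv01_0 -inv01_1.
by rewrite !inv01_lt// ltW.
Qed.

Lemma inv01_continuous : {within `[0, 1], continuous (inv01 f)}.
Proof.
apply: segment_inc_surj_continuous.
  move=> x y; rewrite !in_itv /= => /andP[x0 x1] /andP[y0 y1].
  have [xy|yx] := leP x y; first exact: inv01_le.
  by apply/negbTE; rewrite -ltNge inv01_lt.
rewrite inv01_0 inv01_1 => x /=; rewrite in_itv /= => x01.
by exists (f x); rewrite ?inv01_f//= in_itv /= incr_bij01_itv.
Qed.

(** The interval [[f^-1 a, 1]], where [f] takes the values in [[a, 1]]. *)
Section Level.
Variables (a : R) (ha : 0 < a < 1).
Let xa := inv01 f a.

Lemma level_itv z : xa <= z <= 1 -> 0 <= z <= 1 /\ a <= f z <= 1.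
Proof.
have /andP[x0 x1] := inv01_oo ha => /andP[xz z1].
have z01 : 0 <= z <= 1 by rewrite z1 (le_trans _ xz)// ltW.
split => //; have /andP[_ ->] := incr_bij01_itv z01; rewrite andbT.
have /andP[a0 a1] := ha.
by rewrite -[leLHS](f_inv01 (y := a)) ?(ltW a0) ?(ltW a1)// incr_bij01_le// ltW.
Qed.

Lemma level_inv y : a <= y <= 1 -> xa <= inv01 f y <= 1.
Proof.
have /andP[a0 a1] := ha => /andP[ay y1].
have y01 : 0 <= y <= 1 by rewrite y1 (le_trans _ ay)// ltW.
have /andP[_ ->] := inv01_itv y01; rewrite andbT.
by apply: inv01_le => //; exact: ltW.
Qed.

Lemma inv01_level : f xa = a.
Proof. by case/andP: ha => a0 a1; rewrite f_inv01// !ltW. Qed.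

End Level.

End Inv01.

(** * The best approximant *)

Section BestApprox.
Context {R : realType} (f : R -> R) (hf : incr_bij01 f) (hP : propertyP f).

Lemma relerr_scale r c z : f z != 0 ->
  relerr f (fun x => c * r x) z = c * (1 + relerr f r z) - 1.
Proof. by move=> fz; rewrite /relerr; field. Qed.

Lemma relerrE r z : f z != 0 -> relerr f r z = r z / f z - 1.
Proof. by move=> fz; rewrite /relerr; field. Qed.

(** If the quotients of two values of [s / f] are at most [M], then a multiple of
    [s] approximates [f] with relative error [(M - 1) / (M + 1)]: centre the
    range of [s / f] around [1]. *)
Lemma maxnorm_oscillation (I : set R) (s : R -> R) (M : R) : 1 <= M ->
  (exists z, I z) -> (forall z, I z -> 0 < f z) -> (forall z, I z -> 0 < s z) ->
  (forall y z, I y -> I z -> s y / f y <= M * (s z / f z)) ->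
  exists2 c : R, 0 < c &
    (maxnorm I (relerr f (fun x => c * s x)%R) <= ((M - 1) / (M + 1))%:E)%E.
Proof.
move=> M1 [z0 Iz0] f0 s0 osc.
pose S := [set s z / f z | z in I].
have infS : has_inf S.
  by split; [exists (s z0 / f z0), z0|exists 0 => _ [z Iz <-]; rewrite ltW// divr_gt0 ?s0 ?f0].
have Mp : 0 < M + 1 by lra.
have z0M : s z0 / f z0 / M <= inf S.
  apply: lb_le_inf; first exact: infS.1.
  by move=> _ [z Iz <-]; rewrite ler_pdivrMr ?(lt_le_trans _ M1)// [leRHS]mulrC; exact: osc.
have lo0 : 0 < inf S.
  by apply: lt_le_trans z0M; rewrite !divr_gt0 ?s0 ?f0// (lt_le_trans _ M1).
exists (2 / (inf S * (M + 1))); first by rewrite divr_gt0// mulr_gt0.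
apply: maxnorm_le => z Iz; rewrite relerr_scale ?gt_eqF ?f0// relerrE ?gt_eqF ?f0//.
rewrite [1 + _]addrC subrK.
have lo : inf S <= s z / f z by apply: ge_inf; [exact: infS.2|exists z].
have hi : s z / f z <= M * inf S.
  rewrite [leRHS]mulrC -ler_pdivrMr ?(lt_le_trans _ M1)//.
  apply: lb_le_inf; first exact: infS.1.
  by move=> _ [y Iy <-]; rewrite ler_pdivrMr ?(lt_le_trans _ M1)// [leRHS]mulrC; exact: osc.
set q := s z / f z in lo hi *.
have -> : 2 / (inf S * (M + 1)) * q - 1 = (2 * (q / inf S) - (M + 1)) / (M + 1).
  by field; rewrite !gt_eqF.
rewrite normrM [X in _ * X]gtr0_norm ?invr_gt0//; apply: ler_wpM2r; first by rewrite invr_ge0 ltW.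
have q1 : 1 <= q / inf S by rewrite ler_pdivlMr// mul1r.
have q2 : q / inf S <= M by rewrite ler_pdivrMr.
by rewrite ler_norml; apply/andP; split; lra.
Qed.

Lemma ratfun_const i j (c : R) : ratfun i j (fun=> c).
Proof.
exists c%:P, 1; rewrite size_polyC size_poly1 oner_eq0 coprimep1; split => //.
  by case: (c == 0).
by apply: funext => z; rewrite !hornerE divr1.
Qed.

Section Fixed.
Variables (a : R) (i j : nat) (ha : 0 < a < 1).
Let xa := inv01 f a.
Let r := rbest i j a f.
Let e := relerr f r.
Let I := approx_itv f a.

Let xa01 : 0 < xa < 1. Proof. exact: inv01_oo. Qed.

Let inI z : xa <= z <= 1 -> I z. Proof. by move=> h; rewrite /I /approx_itv /= in_itv. Qed.
Let Iin z : I z -> xa <= z <= 1. Proof. by rewrite /I /approx_itv /= in_itv. Qed.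

Lemma approx_itv_gt0 z : I z -> 0 < f z.
Proof.
move=> /Iin/(level_itv hf ha)[_ /andP[az _]].
by case/andP: ha => a0 _; exact: lt_le_trans az.
Qed.

Lemma rbest_best : is_best_approx i j a f r.
Proof.
have [[g [h [sg sh cgh rE]]] _ _ _] := hP i j ha.
have : r <> (fun=> 0).
  rewrite /r rE => gh0.
  have gh : g * h = 0.
    apply: (@poly_eq0_itv R (g * h) 0 1) => // z _; rewrite hornerM.
    have /eqP : g.[z] / h.[z] = 0 by have /(congr1 (@^~ z)) := gh0.
    by rewrite mulf_eq0 invr_eq0 => /orP[]/eqP->; rewrite ?mul0r ?mulr0.
  by move/eqP: gh; rewrite mulf_eq0 -!size_poly_eq0 sg sh.
by rewrite /r /rbest; case: xgetP => [s -> //|].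
Qed.

Lemma const_error (b : R) : 0 < b < 1 ->
  (maxnorm (approx_itv f b) (relerr f (fun=> 2 * b / (1 + b))%R) <= ((1 - b) / (1 + b))%:E)%E.
Proof.
move=> hb; have /andP[b0 b1] := hb; apply: maxnorm_le => z.
rewrite /approx_itv /= in_itv /= => /(level_itv hf hb)[_ /andP[bz z1]].
have fz0 : 0 < f z by exact: lt_le_trans bz.
rewrite relerrE ?gt_eqF//.
have b10 : 0 < 1 + b by lra.
rewrite ler_norml; apply/andP; split.
  rewrite lerBrDr -mulNr ler_pdivlMr// -ler_pdivlMr//; rewrite -subr_ge0.
  have -> : 2 * b / (1 + b) / f z - (-(1 - b) / (1 + b) + 1) = 2 * b * (1 - f z) / ((1 + b) * f z).
    by field; rewrite !gt_eqF.
  by rewrite divr_ge0 ?mulr_ge0// ?subr_ge0//; lra.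
rewrite -subr_ge0.
have -> : (1 - b) / (1 + b) - (2 * b / (1 + b) / f z - 1) = 2 * (f z - b) / ((1 + b) * f z).
  by field; rewrite !gt_eqF.
by rewrite divr_ge0 ?mulr_ge0// ?subr_ge0//; lra.
Qed.

Let alt : equioscillates_exactly (i + j + 2) xa 1 e.
Proof. by have [] := hP i j ha. Qed.

Let N := (i + j + 2)%N.

Let maxn_fin : exists2 E, 0 <= E & maxnorm I e = E%:E.
Proof.
have [[_ [z [s [s1 zab zlt zs]]]] _] := alt.
have N0 : (0 < N)%N by rewrite /N addn2.
have := zs 0%N N0; have := le_maxnorm e (inI (zab 0%N N0)).
rewrite expr0 mulr1 -/I -/(approx_itv f a) -/xa.
rewrite /I /approx_itv -/xa.
case: (maxnorm _ _) => [E /= | _ | //].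
  by rewrite lee_fin => zE _; exists E => //; exact: le_trans zE.
by case: s1 => ->; rewrite ?mul1e ?EFinN ?mulN1e.
Qed.

(** The best approximant has an error [E] strictly between [0] and [1], and an
    alternation that starts at the left endpoint, with the value [E], and ends
    at [1].  If the endpoints could not be substituted for the extreme points of
    a given alternation, adding one of them would give an alternation that is
    longer than property (P) allows. *)
Lemma rbest_spec : exists E, [/\ 0 < E < 1, E <= (1 - a) / (1 + a), maxnorm I e = E%:E,
    {within `[xa, 1], continuous e}
  & exists y : nat -> R, [/\ y 0%N = xa, y (i + j + 1)%N = 1,
      forall k, (k < i + j + 1)%N -> y k < y k.+1,
      forall k, (k <= i + j + 1)%N -> xa <= y k <= 1
    & forall k, (k <= i + j + 1)%N -> e (y k) = (-1) ^+ k * E] ].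
Proof.
have [E E0 maxE] := maxn_fin.
have [[ce [z [s [s1 zab zlt zs]]]] maxN] := alt.
have [_ _ emax ext1] := hP i j ha.
have /andP[x0 x1] := xa01.
have eE t : xa <= t <= 1 -> `|e t| <= E.
  by move=> /inI/(le_maxnorm e); rewrite maxE lee_fin.
have Ele : E <= (1 - a) / (1 + a).
  rewrite -lee_fin -maxE; apply: le_trans (const_error ha).
  by apply: rbest_best.2; exact: ratfun_const.
have /andP[a0 a1] := ha.
have a10 : 0 < 1 + a by rewrite addr_gt0.
have E1 : E < 1.
  apply: le_lt_trans Ele _; rewrite ltr_pdivrMr// mul1r.
  by rewrite ltrD2l (lt_trans _ a0)// oppr_lt0.
have En0 : 0 < E.
  rewrite lt_neqAle E0 andbT; apply/eqP => E00.
  have e0 t : xa <= t <= 1 -> e t = 0.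
    by move=> /eE; rewrite -E00 normr_le0 => /eqP.
  have : (N.+1 <= N)%N; last by rewrite ltnn.
  apply: maxN; split => //.
  pose y k : R := xa + (1 - xa) * (k%:R / N.+1%:R).
  have yab k : (k < N.+1)%N -> xa <= y k <= 1.
    move=> kN; have k0 : 0 <= k%:R / N.+1%:R :> R by rewrite divr_ge0.
    have k1 : k%:R / N.+1%:R <= 1 :> R by rewrite ler_pdivrMr// mul1r ler_nat ltnW.
    have xx0 : 0 <= 1 - xa by lra.
    rewrite /y lerDl mulr_ge0//=.
    by have := ler_wpM2l xx0 k1; rewrite mulr1 lerBrDl.
  exists y, 1; split => //; first by left.
    move=> k kN; rewrite /y ltrD2l ltr_pM2l ?subr_gt0//.
    by rewrite ltr_pM2r ?invr_gt0// ltr_nat.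
  move=> k kN; have := maxE; rewrite /I /approx_itv -/xa => ->.
  by rewrite (e0 _ (yab k kN)) -E00 mule0.
have zsE k : (k < N)%N -> e (z k) = s * (-1) ^+ k * E.
  by move=> /zs; have := maxE; rewrite /I /approx_itv -/xa => -> [].
have NE : N = (i + j + 1).+1 by rewrite /N addn2 addn1.
have N0 : (0 < N)%N by rewrite NE.
have exa : e xa = E.
  apply/eqP; rewrite eq_le; apply/andP; split.
    have xax : xa <= xa <= 1 by rewrite lexx ltW.
    by have := eE _ xax; rewrite ler_norml => /andP[].
  have N1 : (1 < N)%N by rewrite NE addn1.
  have [sE|sE] := s1.
    by have := zsE _ N0; rewrite sE expr0 !mul1r => <-; apply: emax; apply/inI/zab.
  by have := zsE _ N1; rewrite sE expr1 mulrNN !mul1r => <-; apply: emax; apply/inI/zab.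
(* the first alternation point is a maximum *)
have s1' : s = 1.
  case: s1 => // sE; exfalso; have : (N.+1 <= N)%N; last by rewrite ltnn.
  have z0 : xa < z 0%N.
    have /andP[] := zab _ N0; rewrite le_eqVlt => /orP[/eqP xz|//] _.
    have := zsE _ N0; rewrite -xz exa sE expr0 mulr1 mulN1r => EE.
    by have := En0; rewrite EE oppr_gt0 ltNge (ltW En0).
  apply: maxN; split => //; exists (fun k => if k is k'.+1 then z k' else xa), 1.
  split; [by left| | | ].
  - by case=> [|k] kN; [rewrite lexx ltW|exact: zab].
  - by case=> [|k] kN //; exact: zlt.
  - move=> k kN; have := maxE; rewrite /I /approx_itv -/xa => ->.
    case: k kN => [|k] kN; first by rewrite exa expr0 mulr1 mul1e.
    by rewrite zsE// sE exprS mul1r -EFinM.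
have e1 : `|e 1| = E.
  have := ext1; rewrite /extremum_at -/xa -/e.
  by have := maxE; rewrite /I /approx_itv -/xa => -> [].
have zlast : e 1 = (-1) ^+ (i + j + 1) * E.
  have : e 1 = (-1) ^+ (i + j + 1) * E \/ e 1 = (-1) ^+ N * E.
    move/eqP: e1; rewrite eqr_norml E0 andbT NE exprS mulN1r mulNr.
    rewrite -signr_odd; case: odd; rewrite ?expr0 ?expr1 ?mul1r ?mulN1r ?opprK.
      by case/orP => /eqP->; [right|left].
    by case/orP => /eqP->; [left|right].
  case=> // eN; exfalso; have : (N.+1 <= N)%N; last by rewrite ltnn.
  have lN : (i + j + 1 < N)%N by rewrite NE.
  have z1 : z (i + j + 1)%N < 1.
    have /andP[_] := zab _ lN; rewrite le_eqVlt => /orP[/eqP zz|//].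
    have := zsE _ lN; rewrite zz eN s1' NE exprS mulN1r mul1r mulNr.
    move/eqP; rewrite eq_sym -addr_eq0 -mulr2n mulrn_eq0 /= mulf_eq0 signr_eq0 /= => /eqP EE.
    by move: En0; rewrite EE ltxx.
  apply: maxN; split => //; exists (fun k => if k == N then 1 else z k), 1.
  split; [by left| | | ].
  - move=> k; case: eqVneq => [_ _|kN kN1]; first by rewrite lexx ltW.
    by apply: zab; rewrite ltn_neqAle kN -ltnS.
  - move=> k kN; rewrite (ltn_eqF (kN : (k < N)%N)); case: eqVneq => [|kN'].
      by rewrite NE => -[->].
    by apply: zlt; rewrite ltn_neqAle kN'.
  - move=> k kN; have := maxE; rewrite /I /approx_itv -/xa => ->.
    case: eqVneq => [->|kN']; first by rewrite eN -EFinM mul1r.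
    by rewrite zsE ?s1' -?EFinM// ltn_neqAle kN' -ltnS.
exists E; split => //; first by rewrite En0.
exists (fun k => if k == 0%N then xa else if k == (i + j + 1)%N then 1 else z k).
have p0 : (i + j + 1 == 0)%N = false by rewrite addn1.
have xz k : (0 < k < N)%N -> xa < z k.
  move=> /andP[k0 kN]; have kN' : (k.-1 < N)%N by apply: leq_ltn_trans kN; exact: leq_pred.
  have := zlt k.-1; rewrite prednK// => /(_ kN); apply: le_lt_trans.
  by case/andP: (zab _ kN').
have z1 k : (k.+1 < N)%N -> z k < 1.
  by move=> kN; apply: lt_le_trans (zlt k kN) _; case/andP: (zab _ kN).
split.
- by [].
- by rewrite p0 eqxx.
- move=> k kp /=; rewrite (ltn_eqF kp); case: eqVneq => [_|k0].
    by case: eqVneq => // kp'; apply: xz; rewrite NE ltnS.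
  case: eqVneq => [_|kp']; first by apply: z1; rewrite NE.
  by apply: zlt; rewrite -/N NE ltnS.
- move=> k kp; case: eqVneq => _; first by rewrite lexx ltW.
  case: eqVneq => _; first by rewrite lexx ltW.
  by apply: zab; rewrite -/N NE ltnS.
- move=> k kp; case: eqVneq => [->|k0]; first by rewrite exa expr0 mul1r.
  case: eqVneq => [->|kp']; first exact: zlast.
  by rewrite zsE ?s1' ?mul1r// NE ltnS.
Qed.

Lemma Emin_rbest E : maxnorm I e = E%:E -> Emin i j f I = E%:E.
Proof.
move=> maxE; rewrite -maxE; apply/eqP; rewrite eq_le; apply/andP; split.
  by apply: ereal_inf_lbound; exists r => //; exact: rbest_best.1.
apply: le_ereal_inf_tmp => _ [s rs <-]; exact: rbest_best.2.
Qed.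

(** The multiple of the best approximant with minimal relative error [0]. *)
Lemma rhatE E : 0 < E < 1 -> maxnorm I e = E%:E ->
  (exists2 z, I z & e z = - E) -> rhat i j a f = (fun z => (1 - E)^-1 * r z).
Proof.
move=> /andP[E0 E1] maxE [z0 Iz0 ez0].
have eE t : I t -> - E <= e t by move=> /(le_maxnorm e); rewrite maxE lee_fin ler_norml => /andP[].
have fn0 t : I t -> f t != 0 by move=> /approx_itv_gt0 f0; rewrite gt_eqF.
have E10 : 0 < 1 - E by lra.
apply: xget_unique.
  split; first by exists (1 - E)^-1.
    exists z0 => //; rewrite relerr_scale ?fn0// -/e ez0 mulVf ?subrr// gt_eqF//.
  move=> z Iz; rewrite relerr_scale ?fn0// -/e subr_ge0.
  by rewrite mulrC ler_pdivlMr// mul1r; have := eE _ Iz; lra.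
move=> _ [[c ->] [z1 Iz1 +] cz].
rewrite relerr_scale ?fn0// -/e => /eqP; rewrite subr_eq0 => /eqP c1.
have := cz _ Iz0; rewrite relerr_scale ?fn0// -/e subr_ge0 ez0 => c2.
have e10 : 0 < 1 + e z1 by have := eE _ Iz1; lra.
have c0 : 0 < c by rewrite -(pmulr_lgt0 _ e10) c1.
have c3 : c * (1 - E) <= 1.
  by rewrite -c1; apply: ler_wpM2l; [exact: ltW|have := eE _ Iz1; lra].
have c4 : c * (1 - E) = 1 by apply/eqP; rewrite eq_le c3.
have E1n : 1 - E != 0 by rewrite gt_eqF.
by rewrite -[c](mulfK E1n) c4 mul1r.
Qed.

End Fixed.
End BestApprox.

(** * Composition of alternations *)

Section WithinContinuous.
Context {R : realType}.
Implicit Types (A B : set R) (u v : R -> R).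

Lemma within_continuous_eq A u v : (forall x, A x -> u x = v x) ->
  {within A, continuous u} -> {within A, continuous v}.
Proof.
move=> uv /within_continuousP cu; apply/within_continuousP => x Ax e e0.
have [d d0 H] := cu x Ax e e0; exists d => // y Ay xy.
by rewrite -!uv// H.
Qed.

Lemma within_continuous_compose A B u v : (forall x, A x -> B (u x)) ->
  {within A, continuous u} -> {within B, continuous v} ->
  {within A, continuous (v \o u)}.
Proof.
move=> AB /within_continuousP cu /within_continuousP cv.
apply/within_continuousP => x Ax e e0.
have [d d0 H] := cv (u x) (AB x Ax) e e0.
have [d' d'0 H'] := cu x Ax d d0.
exists d' => // y Ay xy; apply: H; first exact: AB.
exact: H'.
Qed.

Lemma within_continuous_div A u (c : R) : (forall x, A x -> u x != 0) ->
  {within A, continuous u} -> {within A, continuous (fun x => c / u x)}.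
Proof.
move=> u0 /subspace_continuousP cu; apply/subspace_continuousP => x Ax.
by apply: cvgM; [exact: cvg_cst|apply: cvgV; [exact: u0|exact: cu]].
Qed.

End WithinContinuous.

Section Zigzag.
Context {R : realType}.
Implicit Types (u phi : R -> R) (b : nat -> R).

(** A continuous function that goes from [b 0] to [b p.+1] meets the increasing
    levels [b k] at increasing points. *)
Lemma climb x y u b p : x < y -> {within `[x, y], continuous u} ->
  u x = b 0%N -> u y = b p.+1 -> (forall k, (k <= p)%N -> b k < b k.+1) ->
  exists v : nat -> R, [/\ v 0%N = x, v p.+1 = y,
    forall k, (k <= p)%N -> v k < v k.+1 & forall k, (k <= p.+1)%N -> u (v k) = b k].
Proof.
elim: p y => [|p IH] y xy cu ux uy binc.
  exists (fun k => if k is 0%N then x else y); split => //; first by case.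
  by case=> [|[]].
have b0 : b 0%N < b p.+1.
  suff: forall k, (k <= p)%N -> b 0%N < b k.+1 by exact.
  elim=> [|k IHk] kp; first exact: binc.
  by apply: lt_trans (IHk (ltnW kp)) _; apply: binc; rewrite ltnW.
have bp : b p.+1 < b p.+2 by exact: binc.
have [|c] := @IVT _ u x y (b p.+1) (ltW xy) cu.
  rewrite ux uy min_l ?max_r ?(ltW b0) ?(ltW bp)//.
    exact: ltW (lt_trans b0 bp).
  exact: ltW (lt_trans b0 bp).
rewrite in_itv /= => /andP[xc cy] uc.
have {}xc : x < c.
  by rewrite lt_neqAle xc andbT; apply: contraTneq b0 => xc'; rewrite -uc -ux xc' ltxx.
have {}cy : c < y.
  by rewrite lt_neqAle cy andbT; apply: contraTneq bp => cy'; rewrite -uc -uy cy' ltxx.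
have [||v [v0 vp vinc vu]] := IH c xc _ ux uc.
- apply: continuous_subspaceW cu => z /=; rewrite !in_itv /= => /andP[-> zc].
  by rewrite (le_trans zc)// ltW.
- by move=> k kp; apply: binc; exact: leqW.
exists (fun k => if (k <= p.+1)%N then v k else y); split => //.
- by rewrite ltnn.
- move=> k kp; rewrite kp; case: (ltnP k p.+1) => kp'; first exact: vinc.
  by have -> : k = p.+1; [apply/eqP; rewrite eqn_leq kp|rewrite vp].
- move=> k kp; case: leqP => kp'; first exact: vu.
  by have -> : k = p.+2; [apply/eqP; rewrite eqn_leq kp|].
Qed.

Lemma descend x y u b p : x < y -> {within `[x, y], continuous u} ->
  u x = b p.+1 -> u y = b 0%N -> (forall k, (k <= p)%N -> b k < b k.+1) ->
  exists v : nat -> R, [/\ v 0%N = x, v p.+1 = y,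
    forall k, (k <= p)%N -> v k < v k.+1 & forall k, (k <= p.+1)%N -> u (v k) = b (p.+1 - k)%N].
Proof.
move=> xy cu ux uy binc.
have [|||k kp|v [v0 vp vinc vu]] :=
    @climb x y (fun z => - u z) (fun k => - b (p.+1 - k)%N) p xy.
- by move=> z; apply: cvgN; exact: cu.
- by rewrite subn0 ux.
- by rewrite subnn uy.
- by rewrite ltrN2 subSS subSn//; apply: binc; exact: leq_subr.
exists v; split => // k kp.
by have /oppr_inj := vu k kp.
Qed.

(** [u] takes alternately the values [lo] and [hi] at [n + 1] increasing points,
    from [x] to [y] and starting with [lo]. *)
Definition zigzag (x y lo hi : R) n u := exists w : nat -> R,
  [/\ w 0%N = x, w n = y, forall k, (k < n)%N -> w k < w k.+1
    & forall k, (k <= n)%N -> u (w k) = if odd k then hi else lo].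

(** Composition of alternations: on each of the [n] monotone pieces of the zigzag
    of [u], the function [phi \o u] runs through the [p + 1] pieces of [phi],
    forwards or backwards. *)
Lemma zigzag_refine x y lo hi lo' hi' n p u phi b :
  {within `[x, y], continuous u} -> zigzag x y lo hi n u ->
  b 0%N = lo -> b p.+1 = hi -> (forall k, (k <= p)%N -> b k < b k.+1) ->
  (forall k, (k <= p.+1)%N -> phi (b k) = if odd k then hi' else lo') ->
  zigzag x y lo' hi' (n * p.+1) (phi \o u).
Proof.
move=> cu [w [w0 wn winc wu]] b0 bp binc bphi.
have wmono i j : (i <= j)%N -> (j <= n)%N -> w i <= w j.
  move=> ij jn; rewrite -(subnKC ij); move: (subnKC ij); move: (j - i)%N => d dj.
  have {}dj : (i + d <= n)%N by rewrite dj.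
  elim: d dj => [|d IHd] dj; first by rewrite addn0.
  rewrite addnS in dj *; exact: le_trans (IHd (ltnW dj)) (ltW (winc _ dj)).
suff H n' : (n' <= n)%N -> zigzag x (w n') lo' hi' (n' * p.+1) (phi \o u).
  by have := H n (leqnn n); rewrite wn.
elim: n' => [|n' IH] n'n.
  rewrite mul0n; exists (fun=> x); split => //.
  move=> k; rewrite leqn0 => /eqP -> /=.
  by rewrite -[in u x]w0 wu// -b0 bphi.
have [w' [w'0 w'n w'inc w'u]] := IH (ltnW n'n).
have ww : w n' < w n'.+1 by exact: winc.
have cu' : {within `[w n', w n'.+1], continuous u}.
  apply: continuous_subspaceW cu => z /=; rewrite !in_itv /= => /andP[z1 z2].
  rewrite -w0 -wn (le_trans (wmono 0%N n' _ _) z1)//; last exact: ltnW.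
  by rewrite (le_trans z2)// wmono.
have [v [v0 vp vinc vu]] : exists v : nat -> R, [/\ v 0%N = w n', v p.+1 = w n'.+1,
    forall k, (k <= p)%N -> v k < v k.+1
  & forall k, (k <= p.+1)%N -> phi (u (v k)) = if odd (n' * p.+1 + k) then hi' else lo'].
  case: (boolP (odd n')) => on'.
    have [||v [v0 vp vinc vu]] := @descend (w n') (w n'.+1) u b p ww cu' _ _ binc.
    - by rewrite bp wu ?on'// ltnW.
    - by rewrite b0 wu//= on'.
    exists v; split => // k kp; rewrite vu// bphi ?leq_subr// oddB// oddD oddM on'.
    by rewrite andTb.
  have [||v [v0 vp vinc vu]] := @climb (w n') (w n'.+1) u b p ww cu' _ _ binc.
  - by rewrite b0 wu ?(negbTE on')// ltnW.
  - by rewrite bp wu//= on'.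
  exists v; split => // k kp; rewrite vu// bphi// oddD oddM (negbTE on').
  by rewrite andFb addFb.
rewrite mulSn addnC; set N := (n' * p.+1)%N in w'n w'inc w'u vu *.
exists (fun k => if (k <= N)%N then w' k else v (k - N)%N); split.
- by rewrite leq0n.
- by rewrite leqNgt -[X in (X < _)%N]addn0 ltn_add2l /= addKn.
- move=> k kN; case: (ltnP k N) => kN'; first by rewrite (ltnW kN'); exact: w'inc.
  rewrite subSn//; have kp : (k - N <= p)%N by rewrite leq_subLR -ltnS -addnS.
  have := vinc _ kp; case: leqP => // kN''.
  have -> : k = N by apply/eqP; rewrite eqn_leq kN'' kN'.
  by rewrite subnn v0 w'n.
- move=> k kN; case: leqP => kN'; first exact: w'u.
  rewrite /= vu; first by rewrite subnKC// ltnW.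
  by rewrite leq_subLR.
Qed.

End Zigzag.

(** * The iteration *)

Section Iteration.
Context {R : realType} (f : R -> R) (hf : incr_bij01 f) (hP : propertyP f) (m l : nat).

(** The map that sends the quotient [f / f_k] to [f / f_(k+1)]. *)
Definition level_map (a : R) : R -> R := fun y => y / rhat m l a f (inv01 f y).

(** [level_map a] maps [[a, 1]] into [[level_map a a, 1]], and takes the two bounds
    alternately at [m + l + 2] points: on [[a, 1]] it is the function
    [(1 - E) / (1 + e (f^-1 y))], where [e] is the relative error of the best
    approximant. *)
Lemma level_map_spec (a : R) : 0 < a < 1 -> exists E, [/\ 0 < E < 1, E <= (1 - a) / (1 + a),
    Emin m l f (approx_itv f a) = E%:E & level_map a a = (1 - E) / (1 + E)] /\
  [/\ forall y, a <= y <= 1 -> level_map a a <= level_map a y <= 1,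
      {within `[a, 1], continuous (level_map a)}
    & exists b : nat -> R, [/\ b 0%N = a, b (m + l).+1 = 1,
        forall k, (k <= m + l)%N -> b k < b k.+1
      & forall k, (k <= (m + l).+1)%N ->
          level_map a (b k) = if odd k then 1 else level_map a a] ].
Proof.
move=> ha; have /andP[a0 a1] := ha.
have [E [E01 Ea maxE ce [y [y0 yp yinc yI ye]]]] := rbest_spec hf hP m l ha.
have /andP[E0 E1] := E01; rewrite addn1 in yp yinc yI ye.
set r := rbest m l a f in maxE ce ye; set e := relerr f r in maxE ce ye.
have y1I : approx_itv f a (y 1%N) by rewrite /approx_itv /= in_itv /= yI.
have rh := rhatE hf ha E01 maxE.
have {}rh : rhat m l a f = (fun z => (1 - E)^-1 * r z).
  by apply: rh; exists (y 1%N) => //; rewrite -/r -/e ye// expr1 mulN1r.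
have Emn := Emin_rbest hP ha maxE.
have E1n : 0 < 1 - E by lra.
have inv_itv t : a <= t <= 1 -> inv01 f a <= inv01 f t <= 1 by exact: level_inv.
have t01 t : a <= t <= 1 -> 0 <= t <= 1.
  by move=> /andP[t0 ->]; rewrite (le_trans _ t0)// ltW.
have eE t : a <= t <= 1 -> - E <= e (inv01 f t) <= E.
  move=> /inv_itv ti; rewrite -ler_norml -lee_fin -maxE; apply: le_maxnorm.
  by rewrite /approx_itv /= in_itv.
have phiE t : a <= t <= 1 -> level_map a t = (1 - E) / (1 + e (inv01 f t)).
  move=> ta; have ft := f_inv01 hf (t01 t ta).
  have tn0 : t != 0 by case/andP: ta => t0 _; rewrite gt_eqF// (lt_le_trans a0).
  have e1 : 0 < 1 + e (inv01 f t) by have /andP[] := eE t ta; lra.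
  have rE : r (inv01 f t) = t * (1 + e (inv01 f t)).
    by rewrite /e /relerr ft; field.
  rewrite /level_map rh rE; field.
  by rewrite tn0 !gt_eqF.
have yK k : (k <= (m + l).+1)%N -> inv01 f (f (y k)) = y k.
  move=> kp; apply: (inv01_f hf).
  by have [] := level_itv hf ha (yI k kp).
have fyI k : (k <= (m + l).+1)%N -> a <= f (y k) <= 1.
  by move=> kp; have [] := level_itv hf ha (yI k kp).
have aa : a <= a <= 1 by rewrite lexx ltW.
have inva : inv01 f a = y 0%N by rewrite y0.
have phia : level_map a a = (1 - E) / (1 + E).
  by rewrite phiE// inva ye// expr0 mul1r.
exists E; split; split => //.
- move=> t ta; rewrite phia phiE//; have /andP[e1 e2] := eE t ta.
  have E1p : 0 < 1 + E by lra.
  have et : 0 < 1 + e (inv01 f t) by lra.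
  apply/andP; split; last by rewrite ler_pdivrMr//; lra.
  by apply: ler_wpM2l; [exact: ltW|rewrite lef_pV2 ?posrE//; lra].
- apply: (within_continuous_eq (u := fun t => (1 - E) / (1 + e (inv01 f t)))).
    by move=> t /=; rewrite in_itv /= => ta; rewrite phiE.
  apply: within_continuous_div => [t /=|].
    by rewrite in_itv /= => /eE/andP[? _]; rewrite gt_eqF//; lra.
  have cinv : {within `[a, 1], continuous (inv01 f)}.
    apply: continuous_subspaceW (inv01_continuous hf) => t /=.
    by rewrite !in_itv /=; exact: t01.
  have := within_continuous_compose (A := `[a, 1]%classic) _ cinv ce.
  move=> /(_ _) ce'; move=> t; apply: cvgD; first exact: cvg_cst.
  by apply: ce' => z /=; rewrite !in_itv /=; exact: inv_itv.
- exists (fun k => f (y k)); split.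
  + by rewrite y0 inv01_level.
  + by rewrite yp incr_bij01_1.
  + move=> k kp; have /andP[z0 _] := (level_itv hf ha (yI k (leqW kp))).1.
    have /andP[_ z1] := (level_itv hf ha (yI k.+1 kp)).1.
    by apply: incr_bij01_lt => //; exact: yinc.
  + move=> k kp; rewrite phiE ?fyI// yK// ye// -signr_odd phia.
    by case: odd; rewrite ?expr0 ?expr1 ?mul1r ?mulN1r// divff// gt_eqF.
Qed.

Variables (alpha : R) (halpha : 0 < alpha < 1).
Let al := alpha_iter f m l alpha.
Let fk := f_iter f m l alpha.
Let x0 := inv01 f alpha.
Let p := (m + l + 1)%N.

(** The quotient [f / f_k]. *)
Definition level k : R -> R := fun z => f z / fk k z.

Lemma alpha_iterS k : al k.+1 = level_map (al k) (al k). Proof. by []. Qed.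

Lemma levelS k z : level k.+1 z = level_map (al k) (level k z).
Proof. by rewrite /level /level_map /fk /= invfM mulrA. Qed.

(** The quotient [f / f_k] is continuous with values in [[alpha_k, 1]], and takes
    the two bounds alternately. *)
Lemma iter_invariant k : [/\ 0 < al k < 1,
    forall z, x0 <= z <= 1 -> al k <= level k z <= 1,
    {within `[x0, 1], continuous (level k)}
  & zigzag x0 1 (al k) 1 (p ^ k) (level k)].
Proof.
elim: k => [|k [al01 lb lc lz]].
  have lE z : level 0 z = f z by rewrite /level /fk /= divr1.
  have /andP[x00 x01] := inv01_oo hf halpha.
  split => //.
  - by move=> z zx; rewrite lE; have [] := level_itv hf halpha zx.
  - apply: (within_continuous_eq (u := f)) => [z _|]; first by rewrite lE.
    case: hf => fc _ _; apply: continuous_subspaceW fc => z /=.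
    by rewrite !in_itv /= => /andP[xz ->]; rewrite (le_trans _ xz)// ltW.
  - exists (fun k => if k is 0%N then x0 else 1); split => //; first by case.
    by case=> [|[]]//; rewrite lE /= ?incr_bij01_1// (inv01_level hf halpha).
have [E [[/andP[E0 E1] _ _ phia] [phib phic [b [b0 bp binc bphi]]]]] := level_map_spec al01.
have E1p : 0 < 1 + E by lra.
have lvlE z : level_map (al k) (level k z) = level k.+1 z by rewrite levelS.
split.
- rewrite alpha_iterS phia divr_gt0 ?subr_gt0//= ltr_pdivrMr//; lra.
- by move=> z zx; rewrite levelS alpha_iterS; apply/phib/lb.
- apply: (within_continuous_eq (u := level_map (al k) \o level k)).
    by move=> z _ /=; rewrite levelS.
  apply: within_continuous_compose lc phic => z /=.
  by rewrite !in_itv /=; exact: lb.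
- have := zigzag_refine lc lz b0 bp binc bphi.
  rewrite -[(m + l).+1]addn1 -/p -expnSr alpha_iterS.
  case=> w [w0 wn winc wu]; exists w; split => // j jp.
  by rewrite levelS; exact: wu.
Qed.

Lemma relerr_ft k z : x0 <= z <= 1 ->
  relerr f (ft_iter f m l alpha k) z = 2 * al k / (1 + al k) / level k z - 1.
Proof.
move=> zx; have [/andP[a0 _] /(_ z zx)/andP[lz _] _ _] := iter_invariant k.
have l0 : level k z != 0 by rewrite gt_eqF// (lt_le_trans a0).
have [f0 fk0] : f z != 0 /\ fk k z != 0.
  by apply/andP; move: l0; rewrite /level mulf_eq0 invr_eq0 negb_or.
have a10 : 1 + al k != 0 by rewrite gt_eqF// addr_gt0.
rewrite /relerr /ft_iter /level -/(al k) -/(fk k); field.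
by rewrite f0 fk0 a10.
Qed.

Let err k := (1 - al k) / (1 + al k).

Lemma relerr_ft_zigzag k : exists w : nat -> R,
  [/\ w 0%N = x0, w (p ^ k)%N = 1, forall j, (j < p ^ k)%N -> w j < w j.+1,
      forall j, (j <= p ^ k)%N -> x0 <= w j <= 1
    & forall j, (j <= p ^ k)%N ->
        relerr f (ft_iter f m l alpha k) (w j) = (-1) ^+ j * err k].
Proof.
have [/andP[a0 a1] lb lc [w [w0 wn winc wu]]] := iter_invariant k.
have wmono i j : (i <= j)%N -> (j <= p ^ k)%N -> w i <= w j.
  move=> ij jn; rewrite -(subnKC ij); move: (subnKC ij); move: (j - i)%N => d dj.
  have {}dj : (i + d <= p ^ k)%N by rewrite dj.
  elim: d dj => [|d IHd] dj; first by rewrite addn0.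
  rewrite addnS in dj *; exact: le_trans (IHd (ltnW dj)) (ltW (winc _ dj)).
have wI j : (j <= p ^ k)%N -> x0 <= w j <= 1.
  by move=> jp; rewrite -w0 -wn !wmono.
exists w; split => // j jp; rewrite relerr_ft ?wI// wu// -signr_odd /err.
have a10 : 1 + al k != 0 by rewrite gt_eqF// addr_gt0.
by case: odd; rewrite /= ?expr0 ?expr1; field; rewrite a10 ?gt_eqF.
Qed.

Lemma maxnorm_relerr_ft k :
  maxnorm (approx_itv f alpha) (relerr f (ft_iter f m l alpha k)) = (err k)%:E.
Proof.
have [/andP[a0 a1] lb lc _] := iter_invariant k.
have [w [w0 _ _ wI we]] := relerr_ft_zigzag k.
have a10 : 0 < 1 + al k by rewrite addr_gt0.
apply: (maxnorm_attained (z := w 0%N)).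
- move=> z; rewrite /approx_itv /= in_itv /= => zx.
  have /andP[l0 l1] := lb z zx; rewrite relerr_ft// /err.
  have lz0 : 0 < level k z by exact: lt_le_trans l0.
  rewrite ler_norml; apply/andP; split; rewrite -subr_ge0.
    have -> : 2 * al k / (1 + al k) / level k z - 1 - - ((1 - al k) / (1 + al k)) =
      2 * al k * (1 - level k z) / ((1 + al k) * level k z).
      by field; rewrite !gt_eqF.
    apply: divr_ge0; last exact: mulr_ge0 (ltW a10) (ltW lz0).
    by apply: mulr_ge0; [rewrite mulr_ge0// ltW|rewrite subr_ge0].
  have -> : (1 - al k) / (1 + al k) - (2 * al k / (1 + al k) / level k z - 1) =
      2 * (level k z - al k) / ((1 + al k) * level k z).
    by field; rewrite !gt_eqF.
  apply: divr_ge0; last exact: mulr_ge0 (ltW a10) (ltW lz0).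
  by apply: mulr_ge0; [|rewrite subr_ge0].
- by rewrite /approx_itv /= in_itv /= wI.
- by rewrite we// expr0 mul1r ger0_norm// divr_ge0 ?subr_ge0// ltW.
Qed.

Lemma eps_iterE k : eps_iter f m l alpha k = err k.
Proof. by rewrite /eps_iter maxnorm_relerr_ft. Qed.

Lemma alpha_iter_eps k :
  al k = (1 - eps_iter f m l alpha k) / (1 + eps_iter f m l alpha k).
Proof.
have [/andP[a0 a1] _ _ _] := iter_invariant k.
have a10 : 1 + al k != 0 by rewrite gt_eqF// addr_gt0.
rewrite eps_iterE /err; field; rewrite a10 /=.
by rewrite addrACA subrr addr0 gt_eqF// addr_gt0.
Qed.

Lemma eps_iterS k :
  (eps_iter f m l alpha k.+1)%:E = Emin m l f (approx_itv f (al k)) /\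
  0 < eps_iter f m l alpha k.+1 <= eps_iter f m l alpha k.
Proof.
have [al01 _ _ _] := iter_invariant k.
have [E [[/andP[E0 E1] Ea EminE phia] _]] := level_map_spec al01.
have E1p : 1 + E != 0 by rewrite gt_eqF// addr_gt0.
have errE : err k.+1 = E.
  rewrite /err alpha_iterS phia; field; rewrite E1p /=.
  by rewrite addrACA subrr addr0 gt_eqF// addr_gt0.
by rewrite !eps_iterE errE EminE E0.
Qed.

Lemma relerr_ft_equioscillates k : let e := relerr f (ft_iter f m l alpha k) in
  [/\ equioscillates (p ^ k + 1) x0 1 e, extremum_at x0 1 e x0 & extremum_at x0 1 e 1].
Proof.
have [/andP[a0 a1] lb lc _] := iter_invariant k.
have [w [w0 wn winc wI we]] := relerr_ft_zigzag k.
have maxE : maxnorm `[x0, 1] (relerr f (ft_iter f m l alpha k)) = (err k)%:E.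
  exact: maxnorm_relerr_ft.
have err0 : 0 <= err k by rewrite divr_ge0 ?subr_ge0 ?addr_ge0// ltW.
split.
- split.
    apply: (within_continuous_eq
      (u := fun z => 2 * al k / (1 + al k) / level k z - 1)).
      by move=> z /=; rewrite in_itv /= => zx; rewrite relerr_ft.
    move=> z; apply: cvgB; last exact: cvg_cst.
    apply: within_continuous_div => // t /=; rewrite in_itv /= => /lb/andP[l0 _].
    by rewrite gt_eqF// (lt_le_trans a0).
  exists w, 1; split; first by left.
  + by move=> j; rewrite addn1 ltnS; exact: wI.
  + by move=> j; rewrite addn1 ltnS; exact: winc.
  + move=> j; rewrite addn1 ltnS maxE => jp.
    by rewrite we// mul1r EFinM.
- by rewrite /extremum_at maxE -[X in relerr _ _ X]w0 we// expr0 mul1r ger0_norm.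
- by rewrite /extremum_at maxE -[X in relerr _ _ X]wn we// normrM normr_sign mul1r ger0_norm.
Qed.

End Iteration.

(** * Order of approximation near 1 *)

Section Rational.
Context {R : realType}.
Implicit Types (g h : {poly R}) (r : R -> R).

(** A reduced fraction that is bounded on an interval has no pole there. *)
Lemma coprime_bounded_nonzero g h (x y M : R) : x < y -> coprimep g h -> h != 0 ->
  (forall z, x <= z <= y -> `|g.[z] / h.[z]| <= M) ->
  forall z, x <= z <= y -> h.[z] != 0.
Proof.
move=> xy cgh hn0 bnd z zxy; apply/eqP => hz.
have gz : g.[z] != 0.
  apply: contraL cgh => /eqP gz; rewrite /coprimep.
  have : 'X - z%:P %| gcdp g h by rewrite dvdp_gcd !dvdp_XsubCl !rootE gz hz eqxx.
  move/dvdp_leq; rewrite gcdp_eq0 negb_and hn0 orbT size_XsubC => /(_ isT).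
  by case: (size _) => [|[]].
pose D t := `|g.[t]| - M * `|h.[t]|.
have cD : {for z, continuous D}.
  apply: cvgB; first by apply: cvg_norm; exact: continuous_horner.
  by apply: cvgM; [exact: cvg_cst|apply: cvg_norm; exact: continuous_horner].
have Dz : 0 < D z by rewrite /D hz normr0 mulr0 subr0 normr_gt0.
have /cvgrPdist_lt/(_ _ Dz)/nbhs_ballP[d /= d0 dD] := cD.
have Dpos t : `|z - t| < d -> 0 < D t.
  by move=> zt; have := dD t zt; rewrite /= ltr_norml => /andP[_]; lra.
have hroot t : x <= t <= y -> `|z - t| < d -> h.[t] = 0.
  move=> txy zt; apply/eqP; apply: contraTT (Dpos t zt) => ht.
  rewrite -leNgt /D subr_le0.
  by have := bnd t txy; rewrite normrM normfV ler_pdivrMr// normr_gt0.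
case/andP: zxy => xz zy.
have [zlt|zge] := ltP z y.
  have : h = 0; last by apply/eqP.
  apply: (@poly_eq0_itv _ h z (Num.min y (z + d))).
    by rewrite lt_min zlt ltrDl.
  move=> t; rewrite lt_min => /andP[zt /andP[ty td]]; apply: hroot.
    by rewrite (le_trans xz) ltW.
  by rewrite ltr0_norm ?subr_lt0// opprB ltrBlDr addrC.
have zy' : z = y by apply/eqP; rewrite eq_le zy.
have : h = 0; last by apply/eqP.
apply: (@poly_eq0_itv _ h (Num.max x (z - d)) z).
  by rewrite gt_max zy' xy/= -zy' ltrBlDr ltrDl.
move=> t; rewrite gt_max => /andP[/andP[xt td] tz]; apply: hroot.
  by rewrite ltW//= (le_trans (ltW tz)).
by rewrite gtr0_norm ?subr_gt0// ltrBlDr addrC -ltrBlDr.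
Qed.

Lemma horner_const_sign h (x y : R) : x <= y -> (forall z, x <= z <= y -> h.[z] != 0) ->
  (forall z, x <= z <= y -> 0 < h.[z]) \/ (forall z, x <= z <= y -> h.[z] < 0).
Proof.
move=> xy h0; have xx : x <= x <= y by rewrite lexx.
have same z w : x <= z <= y -> x <= w <= y -> z <= w -> 0 < h.[z] * h.[w].
  move=> zxy wxy zw; rewrite lt_neqAle eq_sym mulf_neq0 ?h0//= leNgt; apply/negP => hzw.
  have ch : {within `[z, w], continuous (horner h)}.
    by apply: continuous_subspaceT; exact: continuous_horner.
  have [|c] := @IVT _ (horner h) z w 0 zw ch.
  - have [hz|hz|hz] := ltgtP h.[z] 0.
    + by move: hzw; rewrite nmulr_rlt0// => /ltW hw; rewrite ge_min le_max (ltW hz) hw orbT.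
    + by move: hzw; rewrite pmulr_rlt0// => /ltW hw; rewrite ge_min le_max (ltW hz) hw orbT.
    + by have := h0 z zxy; rewrite hz eqxx.
  - rewrite in_itv /= => /andP[zc cw] /eqP; apply/negP/h0.
    by case/andP: zxy => xz _; case/andP: wxy => _ wy; rewrite (le_trans xz)//= (le_trans cw).
have [hx|hx|hx] := ltgtP 0 h.[x]; last by have := h0 x xx; rewrite -hx eqxx.
- left => z zxy; have := same x z xx zxy; rewrite pmulr_rgt0//; apply.
  by case/andP: zxy.
- right => z zxy; have := same x z xx zxy; rewrite nmulr_rgt0//; apply.
  by case/andP: zxy.
Qed.

Lemma horner_shift1 (q : {poly R}) z : (q \Po ('X + 1)).[z - 1] = q.[z].
Proof. by rewrite horner_comp !hornerE subrK. Qed.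

Lemma horner_unshift1 (q : {poly R}) z : (q \Po ('X - 1)).[z] = q.[z - 1].
Proof. by rewrite horner_comp !hornerE. Qed.

Lemma size_shift1 (q : {poly R}) : size (q \Po ('X + 1)) = size q.
Proof. by apply: size_comp_poly2; rewrite -polyC1 size_XaddC. Qed.

Lemma size_unshift1 (q : {poly R}) : size (q \Po ('X - 1)) = size q.
Proof. by apply: size_comp_poly2; rewrite -polyC1 size_XsubC. Qed.

Lemma ratfun_scale m l (c : R) r : c != 0 -> ratfun m l r ->
  ratfun m l (fun z => c * r z).
Proof.
move=> c0 [g [h [sg sh h0 cgh ->]]]; exists (c *: g), h.
rewrite size_scale// coprimepZl//; split => //.
by apply: funext => z; rewrite hornerZ mulrA.
Qed.

End Rational.

Section Order.
Context {R : realType} (f : R -> R) (hf : incr_bij01 f) (hP : propertyP f).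

(** [g] and [h] are the numerator and the denominator of the best approximant on
    [[x, 1]], in the variable [z - 1] and with the sign that makes [h] positive;
    then [h * f - g = - h * f * e], where [e] is the relative error. *)
Lemma propertyP_alternating a : 0 < a -> alternating_approximants a f.
Proof.
move=> a0 i j x /andP[ax x1].
have x0 : 0 < x by exact: lt_le_trans ax.
have x01 : 0 <= x <= 1 by rewrite !ltW.
have hb : 0 < f x < 1.
  by rewrite -{1}(incr_bij01_0 hf) -{1}(incr_bij01_1 hf) !incr_bij01_lt// ltW.
have invx : inv01 f (f x) = x by exact: inv01_f.
have [E [/andP[E0 E1] _ maxE _ [y [_ _ yinc yI ye]]]] := rbest_spec hf hP i j hb.
have [[g [h [sg sh cgh rE]]] _ _ _] := hP i j hb.
rewrite invx in yI.
set r := rbest i j (f x) f in maxE ye rE.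
have hn0 : h != 0 by rewrite -size_poly_eq0 sh.
have fpos z : x <= z <= 1 -> 0 < f z.
  by move=> zx; apply: (approx_itv_gt0 hf hb); rewrite /approx_itv invx /= in_itv.
have eE z : x <= z <= 1 -> `|relerr f r z| <= E.
  move=> zx; rewrite -lee_fin -maxE; apply: le_maxnorm.
  by rewrite /approx_itv invx /= in_itv.
have rfe z : x <= z <= 1 -> r z = f z * (1 + relerr f r z).
  by move=> zx; rewrite /relerr; field; rewrite gt_eqF// fpos.
have hz : forall z, x <= z <= 1 -> h.[z] != 0.
  apply: (@coprime_bounded_nonzero _ g h x 1 2 x1 cgh hn0) => z zx.
  have -> : g.[z] / h.[z] = r z by rewrite rE.
  rewrite rfe// normrM; have zx' : 0 <= z <= 1.
    by case/andP: zx => xz ->; rewrite (le_trans _ xz)// ltW.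
  have /andP[fz0 fz1] := incr_bij01_itv hf zx'.
  rewrite -[leRHS]mul1r; apply: ler_pM => //; first by rewrite ger0_norm.
  by have := eE z zx; rewrite !ler_norml => /andP[e1 e2]; apply/andP; split; lra.
have key z : x <= z <= 1 -> h.[z] * f z - g.[z] = - (h.[z] * f z * relerr f r z).
  move=> zx; have -> : g.[z] = h.[z] * r z by rewrite rE mulrCA divff ?mulr1 ?hz.
  by rewrite rfe//; ring.
have main (g' h' : {poly R}) : (size g' <= i.+1)%N -> (size h' <= j.+1)%N ->
    (forall z, x <= z <= 1 -> 0 < h'.[z]) ->
    (forall z, x <= z <= 1 -> h'.[z] * f z - g'.[z] = - (h'.[z] * f z * relerr f r z)) ->
    exists g h : {poly R}, [/\ (size g <= i.+1)%N, (size h <= j.+1)%N,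
        forall z, x <= z <= 1 -> 0 < h.[z - 1]
      & alternates x 1 (i + j + 1) (-1) (fun z => h.[z - 1] * f z - g.[z - 1])].
  move=> sg' sh' h'0 key'.
  exists (g' \Po ('X + 1)), (h' \Po ('X + 1)); rewrite !size_shift1; split => //.
    by move=> z zx; rewrite horner_shift1 h'0.
  exists y; split => // k kp; rewrite !horner_shift1 key' ?yI// ye//.
  have -> : -1 * (-1) ^+ k * - (h'.[y k] * f (y k) * ((-1) ^+ k * E)) =
     h'.[y k] * f (y k) * E * ((-1) ^+ k * (-1) ^+ k) by ring.
  by rewrite -expr2 sqrr_sign mulr1 !mulr_gt0// ?h'0 ?fpos ?yI.
have [hpos|hneg] := horner_const_sign (ltW x1) hz.
  by apply: (main g h) => //; rewrite ?sg ?sh.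
apply: (main (- g) (- h)); rewrite ?size_polyN ?sg ?sh//.
  by move=> z zx; rewrite hornerN oppr_gt0 hneg.
move=> z zx; rewrite !hornerN.
have -> : - h.[z] * f z - - g.[z] = - (h.[z] * f z - g.[z]) by ring.
by rewrite key//; ring.
Qed.

(** Local order of approximation, by comparison with the Pade approximant at [1]. *)
Lemma Emin_order alpha m l : 0 < alpha < 1 -> class_C (m + l + 1) `[alpha, 1] f ->
  exists C a1, [/\ 0 <= C, a1 < 1 & forall a, 0 < a < 1 -> a1 <= inv01 f a ->
    (Emin m l f (approx_itv f a) <= (C * (1 - inv01 f a) ^+ (m + l + 1))%:E)%E].
Proof.
move=> /andP[al0 al1] /class_C_chain[D D0 cD].
have alt := propertyP_alternating al0; rewrite -D0 in alt.
have al1' : 1 - alpha <= 1 by rewrite gerBl ltW.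
have f1 : D 0%N 1 != 0 by rewrite D0 incr_bij01_1 ?oner_eq0.
have [g [h [B [sg sh cgh h0 HB]]]] := pade_approximation al1 al1' cD alt f1.
rewrite {}D0 in HB.
pose q := h * h - ((h`_0 / 2) ^+ 2)%:P.
have q0 : 0 < q`_0.
  have -> : q`_0 = 3 / 4 * h`_0 ^+ 2 by rewrite coefB coef0M coefC /=; field.
  by rewrite mulr_gt0// exprn_even_gt0.
have [d d0 qd] := horner_pos_near q0.
pose a1 := Num.max alpha (1 - d / 2).
have a11 : a1 < 1 by rewrite gt_max al1; lra.
have fal0 : 0 < f alpha by rewrite -(incr_bij01_0 hf) incr_bij01_lt// ltW.
exists (`|B| * 2 / (`|h`_0| * f alpha)), a1; split => //.
  by rewrite divr_ge0 ?mulr_ge0// ltW.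
move=> a ha aa1; set x := inv01 f a in aa1 *.
pose r z := (g \Po ('X - 1)).[z] / (h \Po ('X - 1)).[z].
have rr : ratfun m l r.
  exists (g \Po ('X - 1)), (h \Po ('X - 1)); rewrite !size_unshift1; split => //.
    by rewrite -size_poly_eq0 size_unshift1 size_poly_eq0; apply: contraNneq h0 => ->; rewrite coef0.
  exact: coprimep_comp_poly.
apply: le_trans (_ : (maxnorm (approx_itv f a) (relerr f r) <= _)%E).
  by apply: ereal_inf_lbound; exists r.
have /andP[x0 x1] := inv01_oo hf ha; rewrite -/x in x0 x1.
have xal : alpha <= x by apply: le_trans aa1; rewrite le_max lexx.
apply: maxnorm_le => z; rewrite /approx_itv /= in_itv /= -/x => /andP[xz z1].
have zal : alpha <= z <= 1 by rewrite z1 (le_trans xal).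
have zd : 1 - z < d.
  have : 1 - d / 2 <= x by apply: le_trans aa1; rewrite le_max lexx orbT.
  by lra.
have hz : `|h`_0| / 2 < `|h.[z - 1]|.
  have := qd z z1 zd; rewrite hornerD hornerN hornerM hornerC subr_gt0 -expr2.
  rewrite -[X in _ < X](real_normK (num_real _)) exprMn -(real_normK (num_real h`_0)).
  by rewrite -exprMn ltr_pXn2r ?nnegrE ?divr_ge0.
have fz : f alpha <= f z by exact: (incr_bij01_le hf (ltW al0) (le_trans xal xz) z1).
have fz0 : 0 < f z by exact: lt_le_trans fz.
have h00 : 0 < `|h`_0| by rewrite normr_gt0.
have hz0 : h.[z - 1] != 0 by rewrite -normr_gt0; apply: lt_trans hz; rewrite divr_gt0.
have -> : relerr f r z = - (h.[z - 1] * f z - g.[z - 1]) / (h.[z - 1] * f z).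
  by rewrite /relerr /r !horner_unshift1; field; rewrite hz0 gt_eqF.
rewrite normrM normrN normfV normrM (gtr0_norm fz0).
have den : `|h`_0| * f alpha / 2 <= `|h.[z - 1]| * f z.
  by rewrite mulrAC; apply: ler_pM => //; rewrite ?divr_ge0// ltW.
have den0 : 0 < `|h`_0| * f alpha / 2 by rewrite divr_gt0// mulr_gt0.
have bz : B * (1 - z) ^+ (m + l + 1) <= `|B| * (1 - x) ^+ (m + l + 1).
  apply: (@le_trans _ _ (`|B| * (1 - z) ^+ (m + l + 1))).
    by apply: ler_wpM2r; [rewrite exprn_ge0// subr_ge0|exact: ler_norm].
  by apply: ler_wpM2l => //; apply: lerXn2r; rewrite ?nnegrE ?subr_ge0 ?(ltW x1)// lerD2l lerN2.
have den1 : (`|h.[z - 1]| * f z)^-1 <= 2 / (`|h`_0| * f alpha).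
  by rewrite -[2 / _]invf_div lef_pV2// posrE// (lt_le_trans den0).
have -> : `|B| * 2 / (`|h`_0| * f alpha) * (1 - x) ^+ (m + l + 1) =
  (`|B| * (1 - x) ^+ (m + l + 1)) * (2 / (`|h`_0| * f alpha)) by ring.
apply: ler_pM => //; first by rewrite invr_ge0 mulr_ge0// ltW.
exact: le_trans (HB z zal) bz.
Qed.

End Order.

(** * Convergence of the iteration *)

Section Convergence.
Context {R : realType} (f : R -> R) (hf : incr_bij01 f) (hP : propertyP f).
Context (m l : nat) (alpha : R) (halpha : 0 < alpha < 1).
Let al := alpha_iter f m l alpha.

(** A rational function that does better than a constant: it is increasing and
    positive, and the quotients of its values are at most [1 / c]. *)
Lemma increasing_ratfun (c : R) : (m, l) <> (0, 0)%N -> 0 < c < 1 -> exists s : R -> R,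
  [/\ ratfun m l s, forall z, 0 <= z <= 1 -> 0 < s z,
      forall y z, 0 <= y -> y < z -> z <= 1 -> s y < s z
    & forall y z, 0 <= y <= 1 -> 0 <= z <= 1 -> s y / s z <= c^-1].
Proof.
move=> ml /andP[c0 c1]; have [m0|m0] := posnP m.
  have l0 : (0 < l)%N by rewrite lt0n; apply/eqP => l0; apply: ml; rewrite m0 l0.
  exists (fun z => 1 / (1 - (1 - c) * z)).
  have den z : 0 <= z <= 1 -> c <= 1 - (1 - c) * z <= 1.
    by move=> /andP[z0 z1]; apply/andP; split; nra.
  have den0 z : 0 <= z <= 1 -> 0 < 1 - (1 - c) * z.
    by move=> /den/andP[d0 _]; exact: lt_le_trans d0.
  split.
  - exists 1, (1 - (1 - c) *: 'X); split => //.
    + by rewrite size_poly1.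
    + apply: leq_trans (size_polyD _ _) _; rewrite size_poly1 size_polyN geq_max /=.
      by apply: leq_trans (size_scale_leq _ _) _; rewrite size_polyX ltnS.
    + apply/eqP => /(congr1 (fun p : {poly R} => p`_0)).
      by rewrite coefB coefZ coefX coef1 coef0 /= mulr0 subr0 => /eqP; rewrite oner_eq0.
    + exact: coprime1p.
    + by apply: funext => z; rewrite !hornerE.
  - by move=> z /den0 ?; rewrite divr_gt0.
  - move=> y z y0 yz z1.
    have z01 : 0 <= z <= 1 by rewrite z1 (le_trans y0) ?ltW.
    have y01 : 0 <= y <= 1 by rewrite y0 (le_trans (ltW yz)).
    rewrite !div1r ltf_pV2 ?posrE ?den0//.
    by rewrite ltrD2l ltrN2 ltr_pM2l// subr_gt0.
  - move=> y z y01 z01; rewrite !div1r invrK.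
    have /andP[y1 y2] := den y y01; have /andP[z1 z2] := den z z01.
    rewrite -[leRHS]mulr1; apply: ler_pM => //.
    + by rewrite invr_ge0 ltW// (lt_le_trans c0).
    + by rewrite ltW// (lt_le_trans c0).
    + by rewrite lef_pV2 ?posrE// (lt_le_trans c0).
exists (fun z => 1 + (1 - c) * z); split.
- exists (1 + (1 - c) *: 'X), 1; split => //.
  + apply: leq_trans (size_polyD _ _) _; rewrite size_poly1 geq_max /=.
    by apply: leq_trans (size_scale_leq _ _) _; rewrite size_polyX ltnS.
  + by rewrite size_poly1.
  + exact: oner_neq0.
  + exact: coprimep1.
  + by apply: funext => z; rewrite !hornerE divr1.
- by move=> z /andP[z0 z1]; nra.
- by move=> y z y0 yz z1; rewrite ltrD2l ltr_pM2l// subr_gt0.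
- move=> y z /andP[y0 y1] /andP[z0 z1].
  have d0 : 0 < 1 + (1 - c) * z by nra.
  rewrite ler_pdivrMr// [leRHS]mulrC ler_pdivlMr//.
  have e1 : (1 + (1 - c) * y) * c <= (2 - c) * c.
    by apply: ler_wpM2r; [exact: ltW|nra].
  apply: le_trans e1 _; apply: (@le_trans _ _ 1); nra.
Qed.

(** As long as [alpha_k] stays below [b < 1], it grows by at least a fixed factor.
    With an increasing [s], the oscillation of [s / f] on [[f^-1 a, 1]] is at most
    [rho / a]: the quotient of [f z] by [f y] is close to [1 / a] only if [y] and
    [z] are near the left and right endpoints, and then [s y / s z < 1]. *)
Lemma level_map_growth (b : R) : (m, l) <> (0, 0)%N -> 0 < b < 1 ->
  exists2 rho, 0 < rho < 1 & forall a, 0 < a <= b -> a / rho <= level_map f m l a a.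
Proof.
move=> ml /andP[b0 b1].
pose y1 := b + (1 - b) / 3; pose y2 := b + 2 * (1 - b) / 3.
have by1 : b < y1 by rewrite /y1; lra.
have y12 : y1 < y2 by rewrite /y1 /y2; lra.
have y21 : y2 < 1 by rewrite /y2; lra.
have y10 : 0 < y1 by exact: lt_trans by1.
have y20 : 0 < y2 by exact: lt_trans y12.
have y11 : y1 < 1 by exact: lt_trans y21.
have y1I : 0 < y1 < 1 by rewrite y10.
have [s [rs s0 sinc sc]] := increasing_ratfun ml y1I.
have i1 : 0 <= inv01 f y1 <= 1 by apply: inv01_itv => //; rewrite !ltW.
have i2 : 0 <= inv01 f y2 <= 1 by apply: inv01_itv => //; rewrite !ltW.
have i12 : inv01 f y1 < inv01 f y2 by apply: inv01_lt => //; exact: ltW.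
pose th := s (inv01 f y1) / s (inv01 f y2).
have th1 : th < 1.
  rewrite ltr_pdivrMr ?s0// mul1r; apply: sinc => //; first by case/andP: i1.
  by case/andP: i2.
pose rho := Num.max (Num.max th (b / y1)) (Num.max y2 b).
have rb : b <= rho by rewrite !le_max lexx !orbT.
have ry2 : y2 <= rho by rewrite !le_max lexx !orbT.
have rth : th <= rho by rewrite !le_max lexx.
have rby : b / y1 <= rho by rewrite !le_max lexx !orbT.
have rho0 : 0 < rho by exact: lt_le_trans rb.
have rho1 : rho < 1 by rewrite !gt_max th1 b1 y21 ltr_pdivrMr// mul1r by1.
exists rho; first by rewrite rho0.
move=> a /andP[a0 ab].
have ha : 0 < a < 1 by rewrite a0 (le_lt_trans ab).
have [E [[/andP[E0 E1] _ EminE ->] _]] := level_map_spec hf hP m l ha.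
have M1 : 1 <= rho / a by rewrite ler_pdivlMr// mul1r (le_trans ab).
have fa z : approx_itv f a z -> a <= f z <= 1 /\ 0 <= z <= 1.
  by rewrite /approx_itv /= in_itv /= => /(level_itv hf ha)[].
have /andP[ia0 ia1] := inv01_oo hf ha.
have mono y z : 0 <= y <= 1 -> 0 <= z <= 1 -> y <= z -> s y <= s z.
  move=> /andP[y0 _] /andP[_ z1]; rewrite le_eqVlt => /orP[/eqP->//|yz].
  by rewrite ltW// sinc.
have yb : y1^-1 <= rho / a.
  rewrite ler_pdivlMr// (le_trans _ rby)// mulrC ler_pM2r ?invr_gt0//.
have [c c0 maxc] : exists2 c : R, 0 < c & (maxnorm (approx_itv f a)
    (relerr f (fun x => c * s x)%R) <= ((rho / a - 1) / (rho / a + 1))%:E)%E.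
  apply: maxnorm_oscillation => //.
  - by exists 1; rewrite /approx_itv /= in_itv /= lexx ltW.
  - by move=> z /fa[/andP[az _] _]; exact: lt_le_trans az.
  - by move=> z /fa[_]; exact: s0.
  move=> y z /fa[/andP[ay fy1] y01] /fa[/andP[az fz1] z01].
  have fy0 : 0 < f y by exact: lt_le_trans ay.
  have fz0 : 0 < f z by exact: lt_le_trans az.
  have sy0 := s0 y y01; have sz0 := s0 z z01.
  suff : s y / s z * (f z / f y) <= rho / a.
    rewrite -(ler_pM2r (_ : 0 < s z / f z)) ?divr_gt0//; congr (_ <= _).
    by field; rewrite !gt_eqF.
  have s_ge0 : 0 <= s y / s z by rewrite divr_ge0// ltW.
  have f_ge0 : 0 <= f z / f y by rewrite divr_ge0// ltW.
  (* a backward pair: [f z <= f y], and [s y / s z] is at most [1 / y1] *)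
  have [zy|yz] := leP z y.
    rewrite -[rho / a]mulr1; apply: ler_pM => //.
      by apply: le_trans (sc y z y01 z01) yb.
    rewrite ler_pdivrMr// mul1r; apply: incr_bij01_le => //.
      by case/andP: z01.
    by case/andP: y01.
  have s_le1 : s y / s z <= 1.
    by rewrite ler_pdivrMr// mul1r; apply: mono => //; exact: ltW.
  (* a forward pair: either [f z / f y] is bounded away from [1 / a] because
     [f y] or [f z] lies on the wrong side of [y1] or [y2], or [s] grows by a
     definite factor between [y] and [z] *)
  have [fy|fy] := ltP y1 (f y).
    rewrite -[rho / a]mul1r; apply: ler_pM => //; apply: le_trans yb.
    rewrite ler_pdivrMr// (le_trans fz1)// -(ler_pM2l y10) mulr1 mulrA divff ?gt_eqF// mul1r.
    exact: ltW.
  have [fz|fz] := ltP (f z) y2.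
    rewrite -[rho / a]mul1r; apply: ler_pM => //.
    rewrite ler_pdivrMr//; apply: le_trans (ltW fz) _; apply: le_trans ry2 _.
    by rewrite mulrAC -mulrA ler_peMr ?(ltW rho0)// ler_pdivlMr// mul1r.
  have sth : s y / s z <= rho.
    apply: le_trans rth; rewrite /th; apply: ler_pM; rewrite ?invr_ge0 ?(ltW sy0) ?(ltW sz0)//.
      apply: mono => //; rewrite -(inv01_f hf y01); apply: inv01_le => //; exact: ltW.
    rewrite lef_pV2 ?posrE ?s0//; apply: mono => //.
    by rewrite -(inv01_f hf z01); apply: inv01_le => //; exact: ltW.
  apply: ler_pM => //; rewrite ler_pdivrMr// (le_trans fz1)//.
  by rewrite -(ler_pM2l a0) mulr1 mulrA divff ?gt_eqF// mul1r.
have EM : E <= (rho / a - 1) / (rho / a + 1).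
  rewrite -lee_fin -EminE; apply: le_trans maxc.
  apply: ereal_inf_lbound; exists (fun x => c * s x) => //.
  by apply: ratfun_scale => //; rewrite gt_eqF.
have -> : a / rho = (rho / a)^-1 by rewrite invf_div.
move: (rho / a) M1 EM => M M1; have M0 : 0 < M by exact: lt_le_trans M1.
rewrite ler_pdivlMr; last by rewrite addr_gt0.
move=> EM; rewrite ler_pdivlMr; last by rewrite addr_gt0.
rewrite mulrC ler_pdivrMr//; lra.
Qed.

Lemma alpha_iter_nondecreasing k : al k <= al k.+1.
Proof.
have [al01 _ _ _] := iter_invariant hf hP m l halpha k.
have [al01' _ _ _] := iter_invariant hf hP m l halpha k.+1.
have [_ /andP[_]] := eps_iterS hf hP m l halpha k.
rewrite !(eps_iterE hf hP) // -/al.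
case/andP: al01 => a0 _; case/andP: al01' => b0 _.
rewrite ler_pdivrMr ?addr_gt0// mulrAC ler_pdivlMr ?addr_gt0//.
nra.
Qed.

Lemma alpha_iter_mono i j : (i <= j)%N -> al i <= al j.
Proof.
move=> /subnKC <-; elim: (j - i)%N => [|k IH]; first by rewrite addn0.
by rewrite addnS; apply: le_trans IH _; exact: alpha_iter_nondecreasing.
Qed.

Lemma alpha_iter_cvg (d : R) : (m, l) <> (0, 0)%N -> 0 < d ->
  exists K, forall k, (K <= k)%N -> 1 - al k < d.
Proof.
move=> ml d0; suff [K HK] : exists K, 1 - d < al K.
  exists K => k Kk; have := alpha_iter_mono Kk; lra.
apply: contrapT => nK; have le_d k : al k <= 1 - d.
  by rewrite leNgt; apply/negP => kd; apply: nK; exists k.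
have /andP[a0 a1] := halpha.
have d1 : 0 < 1 - d < 1.
  have := le_d 0%N; rewrite {1}/al /= => le0.
  by rewrite (lt_le_trans a0 le0)/= gtrBl.
have [rho /andP[r0 r1] grow] := level_map_growth ml d1.
pose t := alpha * (rho^-1 - 1).
have t0 : 0 < t by rewrite mulr_gt0// subr_gt0 invf_gt1.
have lin k : alpha + k%:R * t <= al k.
  elim: k => [|k IH]; first by rewrite mul0r addr0.
  have alk : alpha <= al k by exact: (alpha_iter_mono (leq0n k)).
  have alk0 : 0 < al k <= 1 - d by rewrite (lt_le_trans a0 alk) le_d.
  have -> : al k.+1 = level_map f m l (al k) (al k) by [].
  apply: le_trans (grow _ alk0).
  have : t <= al k * (rho^-1 - 1) by apply: ler_wpM2r => //; rewrite subr_ge0 invf_ge1// ltW.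
  rewrite mulrBr mulr1 -natr1 mulrDl mul1r => tal; lra.
have := archi_boundP (ltW (divr_gt0 ltr01 t0)); set n := Num.bound _ => tn.
have := lin n; have := le_d n; move: tn; rewrite ltr_pdivrMr//; lra.
Qed.

End Convergence.

Lemma lipschitz_inv01 (R : realType) (f : R -> R) (alpha : R) :
  [lipschitz inv01 f x | x in `[alpha, 1]] -> exists2 L, 0 < L &
  forall x y, alpha <= x <= 1 -> alpha <= y <= 1 ->
    `|inv01 f x - inv01 f y| <= L * `|x - y|.
Proof.
move=> /pinfty_ex_gt0[L L0 HL]; exists L => // x y xa ya.
by apply: (HL (x, y)); split; rewrite /= in_itv.
Qed.

Unset Implicit Arguments.

Theorem theorem3p1 (R : realType) (f : R -> R) (alpha : R) (m l : nat)
    (hf : incr_bij01 f) (hP : propertyP f) (halpha : 0 < alpha < 1) :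
  [/\ forall k : nat,
        alpha_iter f m l alpha k
          = (1 - eps_iter f m l alpha k) / (1 + eps_iter f m l alpha k) /\
        (eps_iter f m l alpha k.+1)%:E = Emin m l f (approx_itv f (alpha_iter f m l alpha k)),
      forall k : nat,
        let e := relerr f (ft_iter f m l alpha k) in
        [/\ equioscillates ((m + l + 1) ^ k + 1) (inv01 f alpha) 1 e,
            extremum_at (inv01 f alpha) 1 e (inv01 f alpha)
          & extremum_at (inv01 f alpha) 1 e 1]
    & class_C (m + l + 1) `[alpha, 1] f ->
      [lipschitz inv01 f x | x in `[alpha, 1]] ->
      (m, l) <> (0, 0)%N ->
      [/\ nonincreasing_seq (eps_iter f m l alpha),
          eps_iter f m l alpha @ \oo --> 0
        & (fun k => eps_iter f m l alpha k.+1)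
            =O_\oo (fun k => eps_iter f m l alpha k ^+ (m + l + 1))] ].
Proof.
split=> [k|k|hC /lipschitz_inv01[L L0 HL] ml].
- split; first exact: alpha_iter_eps.
  by have [] := eps_iterS hf hP m l halpha k.
- exact: relerr_ft_equioscillates.
pose al := alpha_iter f m l alpha; pose eps := eps_iter f m l alpha.
have al01 k : 0 < al k < 1 by have [] := iter_invariant hf hP m l halpha k.
have epsE k : eps k = (1 - al k) / (1 + al k) by exact: eps_iterE.
have eps_pos k : 0 <= eps k.
  by have /andP[a0 a1] := al01 k; rewrite epsE divr_ge0 ?subr_ge0 ?addr_ge0 ?ltW.
split.
- by apply/nonincreasing_seqP => k; have [_ /andP[]] := eps_iterS hf hP m l halpha k.
- apply/cvgrPdist_lt => d d0; have [K HK] := alpha_iter_cvg hf hP halpha ml d0.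
  exists K => // k /= /HK; rewrite sub0r normrN ger0_norm ?eps_pos//; apply: le_lt_trans.
  have /andP[a0 a1] := al01 k; rewrite -/(eps k) epsE ler_pdivrMr ?addr_gt0//.
  by rewrite ler_peMr ?subr_ge0 ?lerDl ?(ltW a0) ?(ltW a1).
have [C [a1 [C0 a11 HC]]] := Emin_order hf hP halpha hC.
have d0 : 0 < (1 - a1) / L by rewrite divr_gt0// subr_gt0.
have [K HK] := alpha_iter_cvg hf hP halpha ml d0.
apply/eqO_exP; exists (C * (2 * L) ^+ (m + l + 1) + 1).
  by rewrite ltr_wpDl// mulr_ge0// exprn_ge0// mulr_ge0// ltW.
exists K => // k /= /HK alk.
have /andP[ak0 ak1] := al01 k.
have ak : alpha <= al k by exact: (alpha_iter_mono hf hP m l halpha (leq0n k)).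
have alpha1 : alpha <= 1 <= (1 : R) by case/andP: halpha => _ /ltW->/=.
have ak' : alpha <= al k <= 1 by rewrite ak ltW.
have := HL 1 (al k) alpha1 ak'; rewrite inv01_1// => lip.
have /andP[i0 i1] := inv01_oo hf (al01 k).
rewrite !gtr0_norm ?subr_gt0// in lip.
have a1i : a1 <= inv01 f (al k).
  by move: alk; rewrite ltr_pdivlMr// mulrC -/(al k) => ?; lra.
have := HC _ (al01 k) a1i; have [<- _] := eps_iterS hf hP m l halpha k.
rewrite lee_fin => epsC.
rewrite normrX !ger0_norm ?eps_pos//; apply: le_trans epsC _.
have al2 : 1 - al k <= 2 * eps k.
  rewrite epsE mulrA ler_pdivlMr ?addr_gt0//; nra.
have lip2 : 1 - inv01 f (al k) <= 2 * L * eps k.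
  by apply: le_trans lip _; rewrite [2 * L]mulrC -mulrA ler_wpM2l// ltW.
apply: (@le_trans _ _ (C * (2 * L * eps k) ^+ (m + l + 1))).
  apply: ler_wpM2l => //; apply: lerXn2r => //; rewrite nnegrE ?subr_ge0 ?(ltW i1)//.
  by rewrite !mulr_ge0// ltW.
rewrite exprMn mulrA ler_wpM2r ?exprn_ge0 ?eps_pos//.
by rewrite lerDl.
Qed.
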